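(* Let $\beta\in\mathbb{C}$ and let $\alpha,\gamma>-1$ be real numbers such that if $\alpha,\gamma\in(-1,0)$ then $\alpha+\gamma+1\neq 0$. Let $\rho\in(0,1)$, $x\in[-1,1]$, and put $R:=\sqrt{1+\rho^2-2\rho x}$. Then $$\frac{(1-x)^{-\alpha/2}}{R^{\beta+1}}\,\mathrm{P}_\beta^{-\alpha}\!\left(\frac{1-\rho}{R}\right)=\frac{\Gamma(\gamma+\alpha+1)}{2^{\alpha/2}\,\Gamma(\alpha+1)\,(1+\rho)^{\beta-\gamma}\rho^{(\gamma+1)/2}}\sum_{k=0}^\infty\frac{(2k+\gamma+\alpha+1)(\gamma+\alpha+1)_k(\alpha+\beta+1)_{2k}}{(\alpha+1)_k}\,\mathrm{P}_{\gamma-\beta}^{-\gamma-\alpha-2k-1}\!\left(\frac{1-\rho}{1+\rho}\right)P_k^{(\alpha,\gamma)}(x).$$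
   Context: $(z)_n:=\prod_{i=1}^n(z+i-1)$ is the Pochhammer symbol. The Jacobi polynomials are $P_n^{(\alpha,\beta)}(z):=\frac{(\alpha+1)_n}{n!}\,{}_2F_1\left(-n,n+\alpha+\beta+1;\alpha+1;\frac{1-z}{2}\right)$, $n\in\mathbb{N}_0=\{0,1,2,\dots\}$. The Ferrers function of the first kind (associated Legendre function on the cut) $\mathrm{P}_\nu^\mu:(-1,1)\to\mathbb{C}$ (upright $\mathrm{P}$) is $$\mathrm{P}_\nu^\mu(t):=\frac{1}{\Gamma(1-\mu)}\left(\frac{1+t}{1-t}\right)^{\mu/2}{}_2F_1\!\left(-\nu,\nu+1;1-\mu;\frac{1-t}{2}\right),$$ where ${}_2F_1$ is the Gauss hypergeometric function. At $x=1$, where $(1-\rho)/R=1$, the left-hand side is understood as its limit as $x\to1^-$. *)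

(* Defs.v *)
From Stdlib Require Import Reals ZArith.
From Coquelicot Require Import Coquelicot.
Open Scope R_scope.

Definition Cexp (z : C) : C :=
  (exp (Re z) * cos (Im z), exp (Re z) * sin (Im z)).

(* The principal power [a ^ z] of a real base [a > 0]; for [a <= 0] the value
   carries no meaning, since [ln] is then a default value. *)
Definition Rcpow (a : R) (z : C) : C := Cexp (z * RtoC (ln a))%C.

Fixpoint pochhammer (z : C) (n : nat) : C :=
  match n with
  | O => RtoC 1
  | S m => (pochhammer z m * (z + RtoC (INR m)))%C
  end.

Definition Gamma_integral (z : C) : C :=
  RInt_gen (V := C_R_CompleteNormedModule)
    (fun t : R => (Rcpow t (z - RtoC 1) * RtoC (exp (- t)))%C)
    (at_right 0) (Rbar_locally p_infty).

(* Euler's integral where [0 < Re z], continued to the left by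
   [Gamma z = Gamma (z + n) / (z)_n], where [n] is [0] if [0 < Re z] and
   otherwise the least natural number with [0 < Re (z + n)].
   At the poles [0, -1, -2, ...] the value is meaningless. *)
Definition Gamma (z : C) : C :=
  let n := Z.to_nat (up (- Re z)) in
  (Gamma_integral (z + RtoC (INR n)) / pochhammer z n)%C.

(* Componentwise sum; it is the sum of the series whenever the series
   converges in [C]. *)
Definition CSeries (u : nat -> C) : C :=
  (Series (fun n => Re (u n)), Series (fun n => Im (u n))).

(* The Gauss series.  It represents the hypergeometric function for
   [Cmod z < 1], and for every [z] when [a] or [b] is a nonpositive integer,
   provided [c] is not a nonpositive integer. *)
Definition hyp2F1 (a b c z : C) : C :=
  CSeries (fun n =>
    pochhammer a n * pochhammer b n / (pochhammer c n * RtoC (INR (fact n)))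
      * z ^ n)%C.

Definition jacobi (n : nat) (alpha beta z : C) : C :=
  (pochhammer (alpha + RtoC 1) n / RtoC (INR (fact n))
   * hyp2F1 (- RtoC (INR n)) (RtoC (INR n) + alpha + beta + RtoC 1)
       (alpha + RtoC 1) ((RtoC 1 - z) / RtoC 2))%C.

(* Meaningful for [-1 < t < 1] and [mu] not a positive integer; for positive
   integers [mu] the formula would have to be read as a limit in [mu]. *)
Definition ferrersP (nu mu : C) (t : R) : C :=
  (/ Gamma (RtoC 1 - mu)
   * Rcpow ((1 + t) / (1 - t)) (mu / RtoC 2)
   * hyp2F1 (- nu) (nu + RtoC 1) (RtoC 1 - mu) (RtoC ((1 - t) / 2)))%C.

(* Main.v *)
Require Import Defs.
From Stdlib Require Import Reals Arith Factorial Lra Lia.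
From Coquelicot Require Import Coquelicot.
Open Scope R_scope.

(** Put c = alpha + 1, a = alpha + beta + 1, s = alpha + gamma + 1 and
    y = (1 - x)/2.  Up to the common factor (rho/2)^(alpha/2) / Gamma(c), both
    sides are the generating function

      G(rho,y) = sum over n of rho^n g_n(y),
      g_n(y) = (a)_n / n! 2F1(-n,n+a;c;y),

    whose coefficients are multiples of the Jacobi polynomials with parameters
    alpha and beta.

    Left-hand side.  A contiguity relation of the g_n says that G satisfies a
    first order partial differential equation, and (1-rho)^a G is constant along
    its characteristics, on which rho y / (1-rho)^2 is constant
    ([gpoly_series_transport]).  The characteristic through (rho,y) passes
    through a point (r,1) with r <= rho.  There the Chu--Vandermonde sum
    evaluates g_n(1), and G(r,1) = 2F1(a,beta+1;c;-r).  On the other hand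
    (1-rho)/R = (1-r)/(1+r), so that the Ferrers function on the left is, up to
    powers, 2F1(beta+1,-beta;c;r/(1+r)), and Pfaff's transformation
    ([pfaff_transformation]) identifies the two ([ferrers_lhs_series]).

    Right-hand side.  The connection formula [gpoly_connection] expands g_n in
    the analogous polynomials with a replaced by s, which are multiples of the
    Jacobi polynomials with parameters alpha and gamma.  It makes G a double
    series; collecting the terms with the k-th of these polynomials gives a
    Gauss function at -rho, which by Pfaff's transformation is the Ferrers
    function in the k-th term on the right ([ferrers_rhs_term]).

    All rearrangements rest on one estimate: g_n(y) is bounded by K q^n for
    every q > 1, uniformly for 0 <= y <= 1 ([gpoly_bound]).  It follows from
    the three-term recurrence, whose limit as n grows has characteristic roots
    of modulus 1.  Applied to the derivatives of the g_n, it also makes G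
    Lipschitz in y, which settles the limit x -> 1.

    The Gamma function enters through its functional equation and its
    nonvanishing at real arguments > -1 other than 0.  The hypothesis on alpha
    and gamma excludes exactly s = 0. *)

Local Notation nC n := (RtoC (INR n)).

(** * Finite sums of complex numbers *)

Definition csum : (nat -> C) -> nat -> C := @sum_n C_AbelianGroup.

Lemma csum_O f : csum f 0 = f 0%nat.
Proof. apply (@sum_O C_AbelianGroup). Qed.

Lemma csum_S f n : csum f (S n) = (csum f n + f (S n))%C.
Proof. apply (@sum_Sn C_AbelianGroup). Qed.

Lemma csum_ext f h n :
  (forall m, (m <= n)%nat -> f m = h m) -> csum f n = csum h n.
Proof. apply (@sum_n_ext_loc C_AbelianGroup). Qed.

Lemma csum_plus f h n :
  csum (fun m => f m + h m)%C n = (csum f n + csum h n)%C.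
Proof. apply (@sum_n_plus C_AbelianGroup). Qed.

Lemma csum_mult_l (x : C) f n : csum (fun m => x * f m)%C n = (x * csum f n)%C.
Proof. apply (@sum_n_mult_l C_Ring). Qed.

Lemma csum_switch (u : nat -> nat -> C) m n :
  csum (fun i => csum (u i) n) m = csum (fun j => csum (fun i => u i j) m) n.
Proof. apply (@sum_n_switch C_AbelianGroup). Qed.

Lemma csum_minus f h n :
  csum (fun m => f m - h m)%C n = (csum f n - csum h n)%C.
Proof.
  replace (csum f n - csum h n)%C with (csum f n + (-(1)) * csum h n)%C by ring.
  rewrite <- csum_mult_l, <- csum_plus.
  apply csum_ext; intros; ring.
Qed.

Lemma csum_shift f n :
  csum f (S n) = (f 0%nat + csum (fun m => f (S m)) n)%C.
Proof.
  induction n.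
  - rewrite csum_S, !csum_O; reflexivity.
  - rewrite csum_S, IHn, (csum_S _ n). ring.
Qed.

Lemma csum_extend f n p :
  (forall m, (n < m)%nat -> f m = RtoC 0) -> csum f (n + p) = csum f n.
Proof.
  intros H; induction p.
  - now rewrite Nat.add_0_r.
  - rewrite Nat.add_succ_r, csum_S, IHp, H by lia. ring.
Qed.

Lemma csum_drop f n p :
  (forall m, (m < p)%nat -> f m = RtoC 0) ->
  csum f (p + n) = csum (fun m => f (p + m)%nat) n.
Proof.
  revert f; induction p; intros f H.
  - reflexivity.
  - change (S p + n)%nat with (S (p + n)).
    rewrite csum_shift, H, IHp by lia || (intros; apply H; lia).
    rewrite Cplus_0_l. apply csum_ext. intros; reflexivity.
Qed.

Lemma Cmod_csum f n : Cmod (csum f n) <= sum_n (fun m => Cmod (f m)) n.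
Proof.
  induction n.
  - rewrite csum_O, sum_O; lra.
  - rewrite csum_S, sum_Sn. unfold plus; simpl.
    eapply Rle_trans; [apply Cmod_triangle|]. apply Rplus_le_compat_r, IHn.
Qed.

(** * Pochhammer symbols and inverse factorials *)

Lemma nC_S n : nC (S n) = (nC n + 1)%C.
Proof. now rewrite S_INR, RtoC_plus. Qed.

Lemma nC_plus n m : nC (n + m) = (nC n + nC m)%C.
Proof. now rewrite plus_INR, RtoC_plus. Qed.

Lemma nC_mult n m : nC (n * m) = (nC n * nC m)%C.
Proof. now rewrite mult_INR, RtoC_mult. Qed.

Lemma nC_neq_0 n : (0 < n)%nat -> nC n <> RtoC 0.
Proof. intros H E. apply RtoC_inj in E. apply (not_0_INR n); auto; lia. Qed.

Lemma fact_nC_neq_0 n : nC (fact n) <> RtoC 0.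
Proof. apply nC_neq_0, lt_O_fact. Qed.

Lemma fact_S n : nC (fact (S n)) = ((nC n + 1) * nC (fact n))%C.
Proof. now rewrite fact_simpl, nC_mult, nC_S. Qed.

Lemma poch_S z n : pochhammer z (S n) = (pochhammer z n * (z + nC n))%C.
Proof. reflexivity. Qed.

Lemma poch_Sl z n : pochhammer z (S n) = (z * pochhammer (z + 1) n)%C.
Proof.
  induction n.
  - simpl. ring.
  - rewrite poch_S, IHn, poch_S, nC_S. ring.
Qed.

Lemma poch_add z n m :
  pochhammer z (n + m) = (pochhammer z n * pochhammer (z + nC n) m)%C.
Proof.
  induction m.
  - rewrite Nat.add_0_r; simpl; ring.
  - rewrite Nat.add_succ_r, !poch_S, IHm, nC_plus. ring.
Qed.

(** The condition on a lower parameter that keeps all denominators nonzero. *)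
Definition nonpole (z : C) : Prop := forall n : nat, (z + nC n)%C <> RtoC 0.

Lemma nonpole_poch z n : nonpole z -> pochhammer z n <> RtoC 0.
Proof.
  intros H; induction n.
  - apply C1_nz.
  - rewrite poch_S. apply Cmult_neq_0; auto.
Qed.

Lemma nonpole_shift z n : nonpole z -> nonpole (z + nC n).
Proof.
  intros H m. replace (z + nC n + nC m)%C with (z + nC (n + m))%C; auto.
  rewrite nC_plus; ring.
Qed.

Lemma nonpole_S z : nonpole z -> nonpole (z + 1).
Proof. intros H. apply (nonpole_shift z 1 H). Qed.

Lemma nonpole_pos (r : R) : 0 < r -> nonpole (RtoC r).
Proof.
  intros H n E. rewrite <- RtoC_plus in E. apply RtoC_inj in E.
  generalize (pos_INR n); lra.
Qed.

Lemma nonpole_gt_m1 (r : R) : -1 < r -> r <> 0 -> nonpole (RtoC r).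
Proof.
  intros H H0 n E. rewrite <- RtoC_plus in E. apply RtoC_inj in E.
  destruct n; [simpl in E; lra|].
  rewrite S_INR in E; generalize (pos_INR n); lra.
Qed.

Lemma poch_one n : pochhammer 1 n = nC (fact n).
Proof.
  induction n; [reflexivity|]. rewrite poch_S, IHn, fact_S. ring.
Qed.

(** The inverse factorial 1/(n-m)!, extended by 0 to m > n, so that sums over m
    can be given any upper limit from n on. *)
Definition rfact (n m : nat) : C :=
  if (m <=? n)%nat then (/ nC (fact (n - m)))%C else RtoC 0.

Lemma rfact_gt n m : (n < m)%nat -> rfact n m = 0.
Proof.
  intros H. unfold rfact. case (Nat.leb_spec m n); auto; lia.
Qed.

Lemma rfact_le n m : (m <= n)%nat -> rfact n m = (/ nC (fact (n - m)))%C.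
Proof.
  intros H. unfold rfact. case (Nat.leb_spec m n); auto; lia.
Qed.

Lemma rfact_diag n : rfact n n = 1.
Proof. rewrite rfact_le, Nat.sub_diag by lia. simpl. now field. Qed.

Lemma rfact_SS n m : rfact (S n) (S m) = rfact n m.
Proof. reflexivity. Qed.

Lemma rfact_0 n : rfact n 0 = (/ nC (fact n))%C.
Proof. rewrite rfact_le, Nat.sub_0_r by lia. reflexivity. Qed.

Lemma rfact_add p n : rfact (p + n) n = (/ nC (fact p))%C.
Proof. rewrite rfact_le by lia. do 4 f_equal. lia. Qed.

Lemma rfact_step n m : ((nC n + 1 - nC m) * rfact (S n) m)%C = rfact n m.
Proof.
  destruct (le_lt_dec m n) as [H|H].
  - rewrite !rfact_le by lia.
    replace n with ((n - m) + m)%nat at 1 by lia.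
    replace (S n - m)%nat with (S (n - m)) by lia.
    rewrite fact_S, nC_plus. field.
    split; [apply fact_nC_neq_0|]. rewrite <- nC_S. apply nC_neq_0. lia.
  - rewrite (rfact_gt n m) by auto.
    destruct (Nat.eq_dec m (S n)) as [->|H'].
    + rewrite nC_S. ring.
    + rewrite rfact_gt by lia. ring.
Qed.

Ltac nz := repeat split; auto using fact_nC_neq_0, nonpole_poch, nonpole_S;
  try (rewrite <- nC_S; apply nC_neq_0; lia).

Lemma rfact_down n m : ((nC n - nC m) * rfact n m)%C = rfact n (S m).
Proof.
  destruct n as [|n].
  - rewrite (rfact_gt 0 (S m)) by lia. destruct m; [simpl; ring|].
    rewrite rfact_gt by lia. ring.
  - rewrite rfact_SS, <- (rfact_step n m), nC_S. reflexivity.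
Qed.

(** Multiplied by n+1 = (n+1-m) + m, the sum for n+1 splits into the sums for
    n with parameters (b,c) and (b+1,c+1); hence the induction over general b
    and c.  The left-hand side is 2F1(-n,b;c;1) / n!, the terminating case of
    Gauss's sum. *)
Lemma chu_vandermonde n : forall b c, nonpole c ->
  csum (fun m => (-(1)) ^ m * rfact n m * pochhammer b m
                 / (pochhammer c m * nC (fact m)))%C n
  = (pochhammer (c - b) n / (pochhammer c n * nC (fact n)))%C.
Proof.
  induction n; intros b c Hc.
  - rewrite csum_O, rfact_diag. simpl. reflexivity || (field; apply C1_nz).
  - assert (Hn : (nC n + 1)%C <> RtoC 0)
      by (rewrite <- nC_S; apply nC_neq_0; lia).
    assert (Hc0 : c <> RtoC 0)
      by (generalize (Hc 0%nat); simpl; now rewrite Cplus_0_r).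
    pose proof (nonpole_S c Hc) as Hc1.
    assert (E : ((nC n + 1) * csum (fun m => (-(1)) ^ m * rfact (S n) m * pochhammer b m
                 / (pochhammer c m * nC (fact m))) (S n)
      = pochhammer (c - b) n / (pochhammer c n * nC (fact n))
        - b / c * (pochhammer (c + 1 - (b + 1)) n / (pochhammer (c + 1) n * nC (fact n))))%C).
    { rewrite <- (IHn b c Hc), <- (IHn (b + 1)%C (c + 1)%C Hc1), <- csum_mult_l.
      rewrite (csum_ext _ (fun m =>
        ((-(1)) ^ m * rfact n m * pochhammer b m / (pochhammer c m * nC (fact m)))
        + nC m * ((-(1)) ^ m * rfact (S n) m * pochhammer b m / (pochhammer c m * nC (fact m))))%C).
      2:{ intros m _. rewrite <- (rfact_step n m). field.
          split; [apply fact_nC_neq_0| now apply nonpole_poch]. }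
      rewrite csum_plus. unfold Cminus. f_equal.
      - rewrite csum_S, (rfact_gt n (S n)) by lia. unfold Cdiv; ring.
      - rewrite csum_shift. simpl (INR 0).
        rewrite Cmult_0_l, Cplus_0_l.
        replace (- (b / c * csum (fun m => (- (1)) ^ m * rfact n m * pochhammer (b + 1) m / (pochhammer (c + 1) m * nC (fact m))) n))%C
          with (- (b / c) * csum (fun m => (- (1)) ^ m * rfact n m * pochhammer (b + 1) m / (pochhammer (c + 1) m * nC (fact m))) n)%C by ring.
        rewrite <- csum_mult_l. apply csum_ext. intros m _.
        rewrite rfact_SS, !poch_Sl, fact_S, nC_S. simpl Cpow. field.
        nz. }
    replace (c + 1 - (b + 1))%C with (c - b)%C in E by ring.
    apply (f_equal (fun z => / (nC n + 1) * z)%C) in E.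
    rewrite Cmult_assoc, Cinv_l, Cmult_1_l in E by auto. rewrite E.
    assert (P : (c * pochhammer (c + 1) n = pochhammer c n * (c + nC n))%C)
      by (rewrite <- poch_Sl; reflexivity).
    assert (P' : pochhammer (c + 1) n = (pochhammer c n * (c + nC n) / c)%C)
      by (rewrite <- P; field; auto).
    rewrite P', !poch_S, fact_S. field.
    repeat split; auto using fact_nC_neq_0, nonpole_poch.
Qed.

(** * Jacobi polynomials as coefficients of the generating function *)

Definition gcoef (a c : C) (n m : nat) : C :=
  (pochhammer a (n + m) * (-(1)) ^ m * rfact n m
   / (pochhammer c m * nC (fact m)))%C.

(** This is (a)_n / n! 2F1(-n,n+a;c;y), that is, (a)_n / (c)_n times the Jacobi
    polynomial of degree n with parameters c-1 and a-c at 1-2y.  In this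
    normalization the connection coefficients do not depend on c, and nothing
    has to be divided by (a)_n, which may vanish. *)
Definition gpoly (a c : C) (n : nat) (y : C) : C :=
  csum (fun m => gcoef a c n m * y ^ m)%C n.

Lemma gcoef_gt a c n m : (n < m)%nat -> gcoef a c n m = 0.
Proof. intros H. unfold gcoef. rewrite rfact_gt by auto. unfold Cdiv. ring. Qed.

Lemma gpoly_extend a c n N y : (n <= N)%nat ->
  gpoly a c n y = csum (fun m => gcoef a c n m * y ^ m)%C N.
Proof.
  intros H. replace N with (n + (N - n))%nat by lia.
  rewrite csum_extend; auto.
  intros m Hm. rewrite gcoef_gt by auto. ring.
Qed.

(** The coefficients of y^m of all the terms are polynomial multiples of
    (a)_(n+m) [rfact (n+2) m], so that a polynomial identity remains.  This is
    the three-term recurrence of the Jacobi polynomials with x = 1 - 2y,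
    alpha = c - 1 and beta = a - c. *)
Lemma gpoly_rec a c n y : nonpole c ->
  (2 * (nC n + 2) * (c + nC n + 1) * (2 * nC n + 1 + a) * gpoly a c (S (S n)) y
   = (2 * nC n + 2 + a)
      * ((2 * nC n + 3 + a) * (2 * nC n + 1 + a) * (1 - 2 * y)
         + (c - 1) ^ 2 - (a - c) ^ 2) * gpoly a c (S n) y
     - 2 * (nC n + a) * (nC n + 1 + (a - c)) * (2 * nC n + 3 + a)
       * gpoly a c n y)%C.
Proof.
  intros Hc.
  assert (Hy : (y * gpoly a c (S n) y)%C = csum (fun m =>
    match m with O => RtoC 0 | S m' => gcoef a c (S n) m' end * y ^ m)%C (S (S n))).
  { rewrite csum_shift. unfold gpoly. rewrite <- csum_mult_l, Cmult_0_l, Cplus_0_l.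
    apply csum_ext. intros m _. simpl Cpow. ring. }
  transitivity
    ((2 * nC n + 2 + a) * ((2 * nC n + 3 + a) * (2 * nC n + 1 + a)
         + (c - 1) ^ 2 - (a - c) ^ 2) * gpoly a c (S n) y
     + - 2 * (2 * nC n + 2 + a) * (2 * nC n + 3 + a) * (2 * nC n + 1 + a)
         * (y * gpoly a c (S n) y)
     + - 2 * (nC n + a) * (nC n + 1 + (a - c)) * (2 * nC n + 3 + a)
       * gpoly a c n y)%C.
  2: ring.
  rewrite Hy, (gpoly_extend a c n (S (S n))), (gpoly_extend a c (S n) (S (S n))) by lia.
  unfold gpoly.
  rewrite <- !csum_mult_l, <- !csum_plus.
  apply csum_ext. intros m _. unfold gcoef.
  rewrite <- (rfact_step n m), <- (rfact_step (S n) m), nC_S.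
  destruct m as [|m].
  - rewrite !Nat.add_0_r, !poch_S, nC_S. simpl (INR 0). simpl fact. simpl Cpow. simpl pochhammer.
    change (INR 1) with 1. field.
  - rewrite rfact_SS.
    rewrite <- (rfact_step (S n) m).
    replace (S n + m)%nat with (n + S m)%nat by lia.
    change (S (S n) + S m)%nat with (S (S (n + S m))).
    change (S n + S m)%nat with (S (n + S m)).
    rewrite !(poch_S a (S _)), !(poch_S a (n + S m)), !nC_S, !nC_plus, (poch_S c), fact_S, !nC_S.
    change (rfact (S (S n)) (S m)) with (rfact (S n) m).
    simpl Cpow. field.
    nz.
Qed.

(** The coefficient form of
    (n+1) g_(n+1) - y g_(n+1)' = (a+n) g_n + y g_n'. *)
Lemma gcoef_step a c n m :
  ((nC n + 1 - nC m) * gcoef a c (S n) m = (a + nC n + nC m) * gcoef a c n m)%C.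
Proof.
  unfold gcoef. rewrite <- (rfact_step n m).
  change (S n + m)%nat with (S (n + m)).
  rewrite poch_S, nC_plus. unfold Cdiv. ring.
Qed.

(** The coefficient form of g_(n+1)' = - a (a+1) / c g_n, where the
    polynomial on the right has the parameters a+2 and c+1. *)
Lemma gcoef_derive a c n m : nonpole c ->
  (nC (S m) * gcoef a c (S n) (S m)
   = - a * (a + 1) / c * gcoef (a + 2) (c + 1) n m)%C.
Proof.
  intros Hc. unfold gcoef. rewrite rfact_SS, (poch_Sl c), fact_S, nC_S.
  replace (S n + S m)%nat with (S (S (n + m))) by lia.
  rewrite !(poch_Sl _ (S _)), !(poch_Sl _ (n + m)).
  replace (a + 1 + 1)%C with (a + 2)%C by ring.
  assert (Hc0 : c <> RtoC 0)
    by (generalize (Hc 0%nat); simpl; now rewrite Cplus_0_r).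
  simpl Cpow. field. nz.
Qed.

Lemma poch_reflect k : forall z,
  pochhammer (- z - nC k + 1) k = ((-(1)) ^ k * pochhammer z k)%C.
Proof.
  induction k; intros z; [simpl; ring|].
  rewrite poch_S, nC_S, (poch_Sl z). simpl Cpow.
  replace (- z - (nC k + 1) + 1)%C with (- (z + 1) - nC k + 1)%C by ring.
  rewrite IHk. ring.
Qed.

Lemma gpoly_1 a c n : nonpole c ->
  gpoly a c n 1
  = ((-(1)) ^ n * pochhammer a n * pochhammer (a - c + 1) n
     / (pochhammer c n * nC (fact n)))%C.
Proof.
  intros Hc. unfold gpoly.
  rewrite (csum_ext _ (fun m => pochhammer a n *
    ((-(1)) ^ m * rfact n m * pochhammer (a + nC n) m / (pochhammer c m * nC (fact m))))%C).
  2:{ intros m _. unfold gcoef. rewrite poch_add, Cpow_1_l. unfold Cdiv; ring. }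
  rewrite csum_mult_l, chu_vandermonde by auto.
  replace (c - (a + nC n))%C with (- (a - c + 1) - nC n + 1)%C by ring.
  rewrite poch_reflect. field. nz.
Qed.

(** * The connection formula *)

Definition connection_term (N : nat) (s B : C) (i : nat) : C :=
  (rfact N i / nC (fact i) * (s + 2 * nC i) * pochhammer B i
   * pochhammer (s - B + nC i + 1) (N - i) / pochhammer (s + nC i) (S N))%C.

(** The terms telescope.  The closed form has the factor M+1-n, so that taking
    all terms makes M+1 times the sum for (M+1,s,B) equal to the sum for
    (M,s+2,B+1). *)
Lemma connection_telescope M s B n : nonpole s -> (n <= S M)%nat ->
  csum (fun i => nC (S M) * connection_term (S M) s B i
        - match i with O => RtoC 0 | S j => connection_term M (s + 2) (B + 1) j end)%C n
  = (pochhammer (B + 1) n * pochhammer (s - B + nC n + 1) (S M - n)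
     * (nC (S M) - nC n) * rfact (S M) n
     / (pochhammer (s + nC n + 1) (S M) * nC (fact n)))%C.
Proof.
  intros Hs. induction n; intros Hn.
  - rewrite csum_O. unfold connection_term.
    rewrite rfact_0, Nat.sub_0_r. simpl (INR 0). simpl (fact 0).
    rewrite !Cplus_0_r, (poch_Sl s (S M)). change (INR 1) with 1. simpl (pochhammer _ 0).
    field. repeat split; auto using fact_nC_neq_0, nonpole_poch, nonpole_S.
    + generalize (Hs 0%nat); simpl; now rewrite Cplus_0_r.
  - rewrite csum_S, IHn by lia. unfold connection_term.
    rewrite rfact_SS, !(rfact_le M n), (rfact_le (S M) n) by lia.
    assert (E : exists p, M = (n + p)%nat) by (exists (M - n)%nat; lia).
    destruct E as [p ->].
    replace (S (n + p) - S n)%nat with p by lia.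
    replace (S (n + p) - n)%nat with (S p) by lia.
    replace (n + p - n)%nat with p by lia.
    rewrite (poch_Sl B n), (poch_S (B + 1) n), (poch_Sl _ p).
    rewrite !fact_S, !nC_S, nC_plus.
    assert (H1 : (s + nC n + 1)%C <> RtoC 0)
      by (replace (s + nC n + 1)%C with (s + nC (S n))%C by (rewrite nC_S; ring); apply Hs).
    assert (H2 : (s + nC n + 1 + (nC n + nC p + 1))%C <> RtoC 0).
    { replace (s + nC n + 1 + (nC n + nC p + 1))%C with (s + nC (S n + S (n + p)))%C
        by (rewrite nC_plus, !nC_S, nC_plus; ring); apply Hs. }
    replace (s + 2 - (B + 1) + nC n + 1)%C with (s - B + nC n + 1 + 1)%C by ring.
    replace (s - B + (nC n + 1) + 1)%C with (s - B + nC n + 1 + 1)%C by ring.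
    replace (s + (nC n + 1))%C with (s + nC n + 1)%C by ring.
    replace (s + 2 + nC n)%C with (s + nC n + 1 + 1)%C by ring.
    set (q := (s + nC n + 1)%C) in *.
    assert (Hq : nonpole (q + 1)).
    { unfold q. apply nonpole_S, nonpole_S, nonpole_shift, Hs. }
    assert (Hq0 : nonpole q) by (unfold q; apply nonpole_S, nonpole_shift, Hs).
    assert (W : pochhammer (q + 1) (S (n + p)) =
      (pochhammer q (S (n + p)) * (q + (nC n + nC p + 1)) / q)%C).
    { transitivity (pochhammer q (S (S (n + p))) / q)%C.
      - rewrite (poch_Sl q). field. auto.
      - rewrite (poch_S q), nC_S, nC_plus. reflexivity. }
    rewrite (poch_S q (S (n + p))), W, nC_S, nC_plus.
    field_simplify_eq; [unfold q; ring|].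
    nz.
Qed.

(** A terminating very well poised 4F3 at -1; it is what comparing coefficients
    in the connection formula leaves to prove. *)
Lemma connection_sum N : forall s B, nonpole s ->
  csum (connection_term N s B) N = (/ nC (fact N))%C.
Proof.
  induction N; intros s B Hs.
  - rewrite csum_O. unfold connection_term. rewrite rfact_diag. simpl.
    field. generalize (Hs 0%nat); simpl; rewrite !Cplus_0_r. auto.
  - pose proof (connection_telescope N s B (S N) Hs (Nat.le_refl _)) as H.
    rewrite csum_minus, csum_mult_l in H.
    rewrite (csum_shift (fun i => match i with O => RtoC 0 | S j => _ end)) in H.
    rewrite Cplus_0_l, IHN in H
      by (replace (s + 2)%C with (s + 1 + 1)%C by ring; now apply nonpole_S, nonpole_S).
    assert (E : (nC (S N) * csum (connection_term (S N) s B) (S N))%C = (/ nC (fact N))%C).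
    { transitivity (nC (S N) * csum (connection_term (S N) s B) (S N) - / nC (fact N) + / nC (fact N))%C;
        [ring|]. unfold csum in *. rewrite H. unfold Cdiv. ring. }
    apply (f_equal (fun z => / nC (S N) * z)%C) in E.
    rewrite Cmult_assoc, Cinv_l, Cmult_1_l in E by (apply nC_neq_0; lia).
    rewrite E, fact_S, nC_S. field. nz.
Qed.

Definition connection_coef (a s : C) (n k : nat) : C :=
  (pochhammer a (n + k) * (s + 2 * nC k) / pochhammer s (S (n + k))
   * ((-(1)) ^ (n - k) * pochhammer (a - s) (n - k) * rfact n k))%C.

(** The coefficient of y^m, with s + 2m, a + n + m and n - m as the s, B and N
    of [connection_sum]. *)
Lemma gpoly_connection a s c n y : nonpole s -> nonpole c ->
  gpoly a c n y = csum (fun k => connection_coef a s n k * gpoly s c k y)%C n.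
Proof.
  intros Hs Hc.
  rewrite (csum_ext (fun k => connection_coef a s n k * gpoly s c k y)%C
    (fun k => csum (fun m => connection_coef a s n k * (gcoef s c k m * y ^ m)) n)%C).
  2:{ intros k Hk. rewrite csum_mult_l, (gpoly_extend s c k n) by auto. reflexivity. }
  rewrite csum_switch. unfold gpoly. apply csum_ext. intros m Hm.
  assert (E : exists p, n = (m + p)%nat) by (exists (n - m)%nat; lia).
  destruct E as [p ->]. rewrite (csum_drop _ p m).
  2:{ intros k Hk. rewrite gcoef_gt by auto. ring. }
  rewrite (csum_ext _ (fun i => pochhammer a (m + p + m) * (-(1)) ^ m / (pochhammer c m * nC (fact m)) * y ^ m
      * connection_term p (s + nC (2 * m)) (a + nC (m + p + m)) i))%C.
  - rewrite csum_mult_l, connection_sum by now apply nonpole_shift.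
    unfold gcoef. rewrite (Nat.add_comm m p), rfact_add. field. nz.
  - intros i Hi. unfold connection_coef, connection_term, gcoef.
    assert (E : exists q, p = (i + q)%nat) by (exists (p - i)%nat; lia).
    destruct E as [q ->].
    replace (m + (i + q) - (m + i))%nat with q by lia.
    replace (i + q - i)%nat with q by lia.
    rewrite (Nat.add_comm m i), rfact_add.
    replace (m + (i + q))%nat with (q + (i + m))%nat by lia. rewrite rfact_add.
    rewrite (Nat.add_comm i q), rfact_add.
    replace (q + (i + m) + (i + m))%nat with (q + (i + m) + m + i)%nat by lia.
    rewrite (poch_add a _ i).
    replace (S (q + (i + m) + m + i)) with ((i + m + m) + S (q + i))%nat by lia.
    rewrite (poch_add s (i + m + m)).
    replace (s + nC (2 * m) + nC i)%C with (s + nC (i + m + m))%C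
      by (rewrite nC_mult, !nC_plus; simpl (INR 2); rewrite RtoC_plus; ring).
    replace (s + nC (2 * m) - (a + nC (q + (i + m) + m)) + nC i + 1)%C
      with (- (a - s) - nC q + 1)%C
      by (rewrite nC_mult, !nC_plus; simpl (INR 2); rewrite RtoC_plus; ring).
    rewrite poch_reflect.
    replace (s + nC (2 * m) + 2 * nC i)%C with (s + 2 * nC (i + m))%C
      by (rewrite nC_mult, !nC_plus; simpl (INR 2); rewrite RtoC_plus; ring).
    pose proof (nonpole_shift s (i + m + m) Hs).
    field. nz.
Qed.

(** * Subexponential bounds *)

Lemma pow_ge_1 q n : 1 <= q -> 1 <= q ^ n.
Proof. intros. apply pow_R1_Rle; auto. Qed.

(** The parameter in Y makes the constant K uniform. *)
Lemma geometric_of_step (Y : Type) (b : nat -> Y -> R) (M : nat -> R) q N :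
  1 < q -> (forall n y, 0 <= b n y <= M n) ->
  (forall n y, (N <= n)%nat -> b (S n) y <= q * b n y) ->
  exists K, 0 <= K /\ forall n y, b n y <= K * q ^ n.
Proof.
  intros Hq HM Hs.
  set (P := fun n => Rabs (M n)).
  assert (HP : forall n k, (n <= k)%nat -> P n <= sum_f_R0 P k).
  { intros n k Hk. induction k.
    - replace n with 0%nat by lia. simpl; lra.
    - simpl. destruct (Nat.eq_dec n (S k)) as [->|Hn].
      + assert (0 <= sum_f_R0 P k) by (apply cond_pos_sum; intros; apply Rabs_pos). lra.
      + specialize (IHk ltac:(lia)). generalize (Rabs_pos (M (S k))). unfold P in *; lra. }
  assert (HK : 0 <= sum_f_R0 P N) by (apply cond_pos_sum; intros; apply Rabs_pos).
  exists (sum_f_R0 P N). split; auto.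
  assert (Hle : forall n y, (n <= N)%nat -> b n y <= sum_f_R0 P N).
  { intros n y Hn. destruct (HM n y) as [_ H]. specialize (HP n N Hn).
    unfold P at 1 in HP. generalize (Rle_abs (M n)); lra. }
  intros n y. destruct (le_lt_dec n N) as [Hn|Hn].
  - generalize (Hle n y Hn) (pow_ge_1 q n); intros. nra.
  - replace n with (N + (n - N))%nat by lia. induction (n - N)%nat as [|p IH].
    + rewrite Nat.add_0_r. generalize (Hle N y (Nat.le_refl N)) (pow_ge_1 q N); intros; nra.
    + rewrite Nat.add_succ_r. eapply Rle_trans; [apply Hs; lia|].
      simpl pow. apply Rmult_le_compat_l with (r := q) in IH; [|lra]. lra.
Qed.

Lemma Cmod_nC n : Cmod (nC n) = INR n.
Proof. rewrite Cmod_R. apply Rabs_pos_eq, pos_INR. Qed.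

Lemma Cmod_plus_ge z w : Cmod w - Cmod z <= Cmod (z + w).
Proof.
  replace w with ((z + w) + - z)%C at 1 by ring.
  generalize (Cmod_triangle (z + w) (- z)). rewrite Cmod_opp. lra.
Qed.

Lemma poch_ratio_bound u v q : nonpole v -> 1 < q ->
  exists K, 0 <= K /\
    forall n, Cmod (pochhammer u n / pochhammer v n) <= K * q ^ n.
Proof.
  intros Hv Hq.
  set (b := fun n (_ : unit) => Cmod (pochhammer u n / pochhammer v n)).
  destruct (INR_unbounded ((Cmod u + q * Cmod v) / (q - 1))) as [N HN].
  destruct (geometric_of_step unit b (fun n => b n tt) q N Hq) as (K & HK & H).
  - intros n y; unfold b; split; [apply Cmod_ge_0|lra].
  - intros n y Hn. unfold b. rewrite !poch_S.
    replace (pochhammer u n * (u + nC n) / (pochhammer v n * (v + nC n)))%C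
      with ((u + nC n) / (v + nC n) * (pochhammer u n / pochhammer v n))%C
      by (field; split; auto using nonpole_poch).
    rewrite Cmod_mult, Cmod_div by auto.
    apply Rmult_le_compat_r; [apply Cmod_ge_0|].
    assert (Hp : 0 < Cmod (v + nC n)) by now apply Cmod_gt_0.
    apply Rle_div_l; auto.
    apply le_INR in Hn. apply Rgt_lt, Rlt_div_l in HN; [|lra].
    generalize (Cmod_triangle u (nC n)) (Cmod_plus_ge v (nC n)).
    rewrite Cmod_nC. intros. nra.
  - exists K; split; auto. intros n; apply (H n tt).
Qed.

Lemma quadratic_bound p0 p1 p2 : exists K, 0 <= K /\
  forall n, Cmod (p0 + p1 * nC n + p2 * nC n ^ 2) <= K * (INR n + 1) ^ 2.
Proof.
  exists (Cmod p0 + Cmod p1 + Cmod p2).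
  pose proof (Cmod_ge_0 p0). pose proof (Cmod_ge_0 p1). pose proof (Cmod_ge_0 p2).
  split; [lra|]. intros n.
  eapply Rle_trans; [apply Cmod_triangle|].
  eapply Rle_trans; [apply Rplus_le_compat_r, Cmod_triangle|].
  rewrite !Cmod_mult, Cmod_pow, Cmod_nC. generalize (pos_INR n); intros.
  assert (0 <= INR n ^ 2) by nra.
  nra.
Qed.

(** After division by the leading coefficient D n ~ 4 n^3, the recurrence
    [gpoly_rec] differs from g_(n+2) = 2 x g_(n+1) - g_n by terms whose
    coefficients are of order n^2 / n^3. *)
Lemma gpoly_rec_limit a c d : nonpole c -> 0 < d ->
  exists N, forall n y, (N <= n)%nat -> 0 <= y <= 1 ->
  Cmod (gpoly a c (S (S n)) (RtoC y) - 2 * (1 - 2 * y) * gpoly a c (S n) (RtoC y)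
        + gpoly a c n (RtoC y))
  <= d * (Cmod (gpoly a c (S n) (RtoC y)) + Cmod (gpoly a c n (RtoC y))).
Proof.
  intros Hc Hd.
  set (D := fun u : C => (2 * (u + 2) * (c + u + 1) * (2 * u + 1 + a))%C).
  set (E := fun u : C => (2 * (u + a) * (u + 1 + (a - c)) * (2 * u + 3 + a))%C).
  set (ka := ((c - 1) ^ 2 - (a - c) ^ 2)%C).
  set (f := fun u => (D u - E u)%C).
  set (h := fun u : C => ((2 * u + 2 + a) * (2 * u + 3 + a) * (2 * u + 1 + a) - 2 * D u)%C).
  (* f and h are the deviations of the coefficients; their cubic terms cancel *)
  assert (Quad : forall F : C -> C, (forall u, F u = F (RtoC 0) + (F (RtoC 1) - F (RtoC (-1))) / 2 * u
            + ((F (RtoC 1) + F (RtoC (-1))) / 2 - F (RtoC 0)) * u ^ 2)%C ->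
          exists K, 0 <= K /\ forall n, Cmod (F (nC n)) <= K * (INR n + 1) ^ 2).
  { intros F HF. destruct (quadratic_bound (F (RtoC 0)) ((F (RtoC 1) - F (RtoC (-1))) / 2)
       ((F (RtoC 1) + F (RtoC (-1))) / 2 - F (RtoC 0))) as (K & HK & H).
    exists K; split; auto. intros n. rewrite HF. apply H. }
  destruct (Quad f) as (K1 & HK1 & B1); [intros u; unfold f, D, E; field|].
  destruct (Quad h) as (K2 & HK2 & B2); [intros u; unfold h, D; field|].
  destruct (Quad (fun u => ka * (2 * u + 2 + a))%C) as (K3 & HK3 & B3); [intros u; cbv beta; field|].
  destruct (INR_unbounded (2 * Cmod c + Cmod a + (K1 + K2 + K3) / d)) as [N HN].
  exists N. intros n y Hn Hy. apply le_INR in Hn.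
  pose proof (Cmod_ge_0 c) as Hc0. pose proof (Cmod_ge_0 a) as Ha0. pose proof (pos_INR n) as Hn0.
  assert (HKd : 0 <= (K1 + K2 + K3) / d) by (apply Rle_div_r; lra).
  assert (HD : (INR n + 1) ^ 3 <= Cmod (D (nC n))).
  { unfold D. rewrite !Cmod_mult.
    replace (c + nC n + 1)%C with (c + RtoC (INR n + 1))%C by (rewrite RtoC_plus; ring).
    replace (2 * nC n + 1 + a)%C with (a + RtoC (2 * INR n + 1))%C by (rewrite RtoC_plus, RtoC_mult; ring).
    pose proof (Cmod_plus_ge c (RtoC (INR n + 1))) as L1.
    pose proof (Cmod_plus_ge a (RtoC (2 * INR n + 1))) as L2.
    rewrite <- RtoC_plus.
    rewrite Cmod_R, Rabs_pos_eq in L1 by lra. rewrite Cmod_R, Rabs_pos_eq in L2 by lra.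
    rewrite !(Cmod_R _), !Rabs_pos_eq by lra.
    assert (M1 : (INR n + 1) / 2 <= Cmod (c + RtoC (INR n + 1))) by lra.
    assert (M2 : INR n + 1 <= Cmod (a + RtoC (2 * INR n + 1))) by lra.
    apply Rle_trans with (2 * (INR n + 2) * ((INR n + 1) / 2) * (INR n + 1)); [nra|].
    apply Rmult_le_compat; try nra. }
  assert (HD0 : 0 < Cmod (D (nC n))) by (apply Rlt_le_trans with (2 := HD); apply pow_lt; lra).
  assert (HDz : D (nC n) <> RtoC 0) by now apply Cmod_gt_0.
  set (G2 := gpoly a c (S (S n)) (RtoC y)). set (G1 := gpoly a c (S n) (RtoC y)).
  set (G0 := gpoly a c n (RtoC y)).
  set (e := (G2 - 2 * (1 - 2 * y) * G1 + G0)%C).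
  assert (He : (D (nC n) * e = ((1 - 2 * y) * h (nC n) + ka * (2 * nC n + 2 + a)) * G1
                + f (nC n) * G0)%C).
  { unfold e, D. pose proof (gpoly_rec a c n (RtoC y) Hc) as R.
    fold G2 G1 G0 in R.
    transitivity ((2 * (nC n + 2) * (c + nC n + 1) * (2 * nC n + 1 + a) * G2)
       + 2 * (nC n + 2) * (c + nC n + 1) * (2 * nC n + 1 + a) * (- (2 * (1 - 2 * y) * G1) + G0))%C;
      [ring|]. rewrite R. unfold h, f, D, E, ka. ring. }
  apply (f_equal Cmod) in He. rewrite Cmod_mult in He.
  assert (Hx : Cmod (1 - 2 * y) <= 1).
  { rewrite <- RtoC_mult, <- RtoC_minus, Cmod_R. apply Rabs_le; lra. }
  assert (T : Cmod (((1 - 2 * y) * h (nC n) + ka * (2 * nC n + 2 + a)) * G1 + f (nC n) * G0)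
     <= (K1 + K2 + K3) * (INR n + 1) ^ 2 * (Cmod G1 + Cmod G0)).
  { specialize (B1 n). specialize (B2 n). specialize (B3 n). cbv beta in B3.
    pose proof (Cmod_ge_0 G1). pose proof (Cmod_ge_0 G0).
    assert (0 <= (INR n + 1) ^ 2) by nra.
    eapply Rle_trans; [apply Cmod_triangle|]. rewrite !(Cmod_mult _ G1), (Cmod_mult _ G0).
    assert (T1 : Cmod ((1 - 2 * y) * h (nC n) + ka * (2 * nC n + 2 + a)) <= (K2 + K3) * (INR n + 1) ^ 2).
    { eapply Rle_trans; [apply Cmod_triangle|]. rewrite (Cmod_mult _ (h _)).
      pose proof (Cmod_ge_0 (h (nC n))). nra. }
    assert (0 <= (K2 + K3) * (INR n + 1) ^ 2 * Cmod G0) by (repeat apply Rmult_le_pos; lra).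
    assert (0 <= K1 * (INR n + 1) ^ 2 * Cmod G1) by (repeat apply Rmult_le_pos; lra).
    apply Rle_trans with ((K2 + K3) * (INR n + 1) ^ 2 * Cmod G1 + K1 * (INR n + 1) ^ 2 * Cmod G0); [|nra].
    apply Rplus_le_compat; apply Rmult_le_compat_r; auto. }
  apply Rmult_le_reg_l with (1 := HD0). rewrite He.
  eapply Rle_trans; [apply T|].
  rewrite <- Rmult_assoc. apply Rmult_le_compat_r.
  { generalize (Cmod_ge_0 G1) (Cmod_ge_0 G0); lra. }
  apply Rle_trans with ((INR n + 1) ^ 3 * d); [|apply Rmult_le_compat_r; lra].
  assert (K1 + K2 + K3 <= (INR n + 1) * d).
  { apply Rle_div_l; lra. }
  assert (0 <= (INR n + 1) ^ 2) by nra. nra.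
Qed.

Lemma gpoly_crude a c n y : 0 <= y <= 1 ->
  Cmod (gpoly a c n (RtoC y)) <= sum_n (fun m => Cmod (gcoef a c n m)) n.
Proof.
  intros Hy. eapply Rle_trans; [apply Cmod_csum|].
  apply sum_n_m_le. intros k. rewrite Cmod_mult, Cmod_pow, Cmod_R, Rabs_pos_eq by lra.
  generalize (Cmod_ge_0 (gcoef a c n k)) (pow_incr y 1 k). rewrite pow1.
  intros. assert (0 <= y ^ k) by (apply pow_le; lra). nra.
Qed.

(** The limiting recurrence g_(n+2) = 2 x g_(n+1) - g_n factors through the
    unimodular numbers zeta and 1/zeta, where zeta = x + i sqrt (1 - x^2):
    it keeps |g_(n+1) - zeta g_n| constant, and |g_(n+1)| exceeds |g_n| by at
    most that quantity.  The norm |g_(n+1) - zeta g_n| + l |g_(n+1)| with a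
    small weight l therefore grows by a factor close to 1 at each step, also at
    x = 1 and x = -1, where zeta and 1/zeta coincide. *)
Lemma gpoly_bound a c q : nonpole c -> 1 < q ->
  exists K, 0 <= K /\
    forall n y, 0 <= y <= 1 -> Cmod (gpoly a c n (RtoC y)) <= K * q ^ n.
Proof.
  intros Hc Hq.
  set (l := Rmin ((q - 1) / 3) 1).
  assert (Hl : 0 < l) by (apply Rmin_glb_lt; lra).
  assert (Hl1 : l <= 1) by apply Rmin_r.
  assert (Hlq : 3 * l <= q - 1) by (generalize (Rmin_l ((q - 1) / 3) 1); unfold l; lra).
  set (d := l / (2 / l + 1)).
  assert (H2l : 0 < 2 / l + 1) by (assert (0 < 2 / l) by (apply Rdiv_lt_0_compat; lra); lra).
  assert (Hd : 0 < d) by (apply Rdiv_lt_0_compat; auto).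
  assert (Hdl : d * (2 / l + 1) = l) by (unfold d; field; split; lra).
  destruct (gpoly_rec_limit a c d Hc Hd) as [N HN].
  set (Y := {y : R | 0 <= y <= 1}).
  set (x := fun y : Y => 1 - 2 * proj1_sig y).
  set (zeta := fun y : Y => ((x y, sqrt (1 - x y ^ 2)) : C)).
  set (g := fun n (y : Y) => gpoly a c n (RtoC (proj1_sig y))).
  set (b := fun n y => Cmod (g (S n) y - zeta y * g n y) + l * Cmod (g (S n) y)).
  set (M := fun n => sum_n (fun m => Cmod (gcoef a c n m)) n).
  assert (Hx2 : forall y, 0 <= 1 - x y ^ 2)
    by (intros [y Hy]; unfold x; simpl proj1_sig; nra).
  assert (Hz : forall y, Cmod (zeta y) = 1).
  { intros y. unfold Cmod, zeta; simpl fst; simpl snd.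
    rewrite pow2_sqrt by apply Hx2.
    transitivity (sqrt 1); [f_equal; ring|apply sqrt_1]. }
  assert (Hz2 : forall y, (2 * x y - zeta y)%C = Cconj (zeta y)).
  { intros y. unfold zeta, Cconj, Cminus, Cplus, Copp, Cmult, RtoC; simpl. f_equal; ring. }
  assert (HzC : forall y, (zeta y * Cconj (zeta y))%C = 1)
    by (intros y; rewrite <- Cmod2_conj, Hz; f_equal; ring).
  assert (HM : forall n y, Cmod (g n y) <= M n)
    by (intros n [y Hy]; exact (gpoly_crude a c n y Hy)).
  destruct (geometric_of_step Y b (fun n => M (S n) + M n + l * M (S n)) q N Hq)
    as (K & HK & HB).
  - intros n y. unfold b. split.
    + generalize (Cmod_ge_0 (g (S n) y - zeta y * g n y)) (Cmod_ge_0 (g (S n) y)); nra.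
    + generalize (Cmod_triangle (g (S n) y) (- (zeta y * g n y))).
      rewrite Cmod_opp, Cmod_mult, Hz, Rmult_1_l.
      generalize (HM n y) (HM (S n) y). unfold Cminus. nra.
  - intros n y Hn.
    set (e := (g (S (S n)) y - 2 * x y * g (S n) y + g n y)%C).
    assert (He : Cmod e <= d * (Cmod (g (S n) y) + Cmod (g n y))).
    { unfold e, g, x. destruct y as [y Hy]; simpl proj1_sig. rewrite RtoC_minus, RtoC_mult.
      apply HN; auto. }
    set (s0 := Cmod (g (S n) y - zeta y * g n y)) in *.
    set (s1 := Cmod (g (S (S n)) y - zeta y * g (S n) y)) in *.
    assert (S1 : s1 <= s0 + Cmod e).
    { unfold s1, s0.
      replace (g (S (S n)) y - zeta y * g (S n) y)%C
        with (Cconj (zeta y) * (g (S n) y - zeta y * g n y) + e)%C.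
      - eapply Rle_trans; [apply Cmod_triangle|].
        rewrite Cmod_mult, Cmod_conj, Hz; lra.
      - unfold e. rewrite <- Hz2.
        transitivity (g (S (S n)) y - zeta y * g (S n) y
           + (1 - zeta y * (2 * x y - zeta y)) * g n y)%C; [ring|].
        rewrite Hz2, HzC. ring. }
    assert (G0 : Cmod (g n y) <= Cmod (g (S n) y) + s0).
    { rewrite <- (Rmult_1_l (Cmod (g n y))), <- (Hz y), <- Cmod_mult.
      replace (zeta y * g n y)%C with (g (S n) y + - (g (S n) y - zeta y * g n y))%C by ring.
      eapply Rle_trans; [apply Cmod_triangle|]. rewrite Cmod_opp. unfold s0; lra. }
    assert (G2 : Cmod (g (S (S n)) y) <= Cmod (g (S n) y) + s1).
    { replace (g (S (S n)) y) with (zeta y * g (S n) y + (g (S (S n)) y - zeta y * g (S n) y))%C by ring.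
      eapply Rle_trans; [apply Cmod_triangle|]. rewrite Cmod_mult, Hz. unfold s1; lra. }
    unfold b. fold s0 s1.
    set (u := Cmod (g (S n) y)) in *.
    assert (Hu : 0 <= u) by apply Cmod_ge_0. assert (Hs0 : 0 <= s0) by apply Cmod_ge_0.
    assert (He2 : Cmod e <= l * (s0 + l * u)).
    { apply Rle_trans with (d * (2 * u + s0)); [eapply Rle_trans; [apply He|]; apply Rmult_le_compat_l; lra|].
      rewrite <- Hdl at 1. rewrite Rmult_assoc. apply Rmult_le_compat_l; [lra|].
      replace ((2 / l + 1) * (s0 + l * u)) with (2 * u + s0 + (2 / l * s0 + l * u)) by (field; lra).
      assert (0 <= 2 / l * s0) by (apply Rmult_le_pos; [apply Rlt_le, Rdiv_lt_0_compat|]; lra).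
      assert (0 <= l * u) by nra. lra. }
    assert (0 <= s0 + l * u) by nra.
    apply Rle_trans with ((1 + l) * (s0 + l * u + Cmod e)); [nra|].
    apply Rle_trans with ((1 + l) * ((1 + l) * (s0 + l * u))); [nra|].
    rewrite <- Rmult_assoc. apply Rmult_le_compat_r; nra.
  - exists (K / l + M 0%nat).
    assert (M0 : 0 <= M 0%nat) by (unfold M; rewrite sum_O; apply Cmod_ge_0).
    assert (HKl : 0 <= K / l) by (apply Rle_div_r; lra).
    split; [lra|].
    intros n y Hy. set (y' := exist _ y Hy : Y).
    change (Cmod (g n y') <= (K / l + M 0%nat) * q ^ n).
    destruct n as [|n].
    + generalize (HM 0%nat y'). simpl pow. lra.
    + specialize (HB n y'). unfold b in HB.
      pose proof (Cmod_ge_0 (g (S n) y' - zeta y' * g n y')).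
      assert (Q : q ^ n <= q ^ S n) by (apply Rle_pow; lia || lra).
      assert (0 < q ^ S n) by (apply pow_lt; lra).
      assert (0 < q ^ n) by (apply pow_lt; lra).
      apply Rle_trans with (K / l * q ^ S n); [|nra].
      apply Rle_trans with (K / l * q ^ n); [|nra].
      apply Rmult_le_reg_l with l; auto.
      replace (l * (K / l * q ^ n)) with (K * q ^ n) by (field; lra). lra.
Qed.

(** * Complex sequences and series *)

(** Convergence in C as a real limit, to which the squeeze lemmas apply. *)
Definition Clim (u : nat -> C) (l : C) : Prop :=
  is_lim_seq (fun n => Cmod (u n - l)) 0.

Lemma Clim_le u l e : (forall n, Cmod (u n - l) <= e n) -> is_lim_seq e 0 -> Clim u l.
Proof.
  intros H He. apply is_lim_seq_le_le with (fun _ => 0) e; auto.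
  - intros n; split; [apply Cmod_ge_0|apply H].
  - apply is_lim_seq_const.
Qed.

Lemma Clim_ext u v l : (forall n, u n = v n) -> Clim u l -> Clim v l.
Proof. intros H. apply is_lim_seq_ext. intros n; now rewrite H. Qed.

Lemma Clim_plus u v l m : Clim u l -> Clim v m -> Clim (fun n => u n + v n)%C (l + m)%C.
Proof.
  intros Hu Hv.
  apply Clim_le with (fun n => Cmod (u n - l) + Cmod (v n - m)).
  - intros n. replace (u n + v n - (l + m))%C with ((u n - l) + (v n - m))%C by ring.
    apply Cmod_triangle.
  - rewrite <- (Rplus_0_r 0). now apply is_lim_seq_plus'.
Qed.

Lemma Clim_mult_l c u l : Clim u l -> Clim (fun n => c * u n)%C (c * l)%C.
Proof.
  intros Hu. apply Clim_le with (fun n => Cmod c * Cmod (u n - l)).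
  - intros n. rewrite <- Cmod_mult. right; f_equal; ring.
  - rewrite <- (Rmult_0_r (Cmod c)). now apply is_lim_seq_mult'; [apply is_lim_seq_const|].
Qed.

Lemma Clim_unique u l m : Clim u l -> Clim u m -> l = m.
Proof.
  intros Hl Hm. apply Ceq_minus, Cmod_eq_0, Rle_antisym; [|apply Cmod_ge_0].
  assert (H : is_lim_seq (fun n => Cmod (u n - l) + Cmod (u n - m)) (0 + 0))
    by now apply is_lim_seq_plus'.
  rewrite Rplus_0_r in H.
  apply (is_lim_seq_le (fun _ => Cmod (l - m)) _ (Cmod (l - m)) 0) in H; auto.
  - intros n. replace (l - m)%C with (- (u n - l) + (u n - m))%C by ring.
    eapply Rle_trans; [apply Cmod_triangle|]. rewrite Cmod_opp; lra.
  - apply is_lim_seq_const.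
Qed.

Lemma is_series_Clim (u : nat -> C) (s : C) : is_series u s <-> Clim (csum u) s.
Proof.
  unfold is_series, Clim. rewrite <- is_lim_seq_spec. split.
  - intros H eps. destruct (proj1 (filterlim_locally _ _) H (pos_div_2 eps)) as [N HN].
    exists N. intros n Hn. rewrite Rminus_0_r, Rabs_pos_eq by apply Cmod_ge_0.
    apply Rlt_trans with (sqrt 2 * pos_div_2 eps).
    + apply C_NormedModule_mixin_compat2. apply (HN n Hn).
    + simpl. assert (sqrt 2 < 2).
      { rewrite <- (sqrt_pow2 2) at 2 by lra. apply sqrt_lt_1; lra. }
      generalize (cond_pos eps); nra.
  - intros H. apply filterlim_locally. intros eps. destruct (H eps) as [N HN].
    exists N. intros n Hn. apply C_NormedModule_mixin_compat1.
    specialize (HN n Hn). rewrite Rminus_0_r, Rabs_pos_eq in HN by apply Cmod_ge_0.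
    exact HN.
Qed.

Lemma is_series_C_unique (u : nat -> C) (s s' : C) : is_series u s -> is_series u s' -> s = s'.
Proof. intros H H'. apply is_series_Clim in H, H'. now apply Clim_unique with (csum u). Qed.

Lemma is_series_Cmult_l (c : C) (u : nat -> C) (s : C) : is_series u s -> is_series (fun n => c * u n)%C (c * s)%C.
Proof.
  intros H. apply is_series_Clim in H. apply is_series_Clim.
  apply (Clim_mult_l c) in H. revert H. apply Clim_ext. intros n; now rewrite csum_mult_l.
Qed.

Lemma CSeries_unique (u : nat -> C) (s : C) : is_series u s -> CSeries u = s.
Proof.
  intros H. apply is_series_Clim in H. unfold CSeries.
  assert (HR : forall n, Re (csum u n) = sum_n (fun k => Re (u k)) n).
  { induction n; [now rewrite csum_O, sum_O|]. rewrite csum_S, sum_Sn, <- IHn. reflexivity. }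
  assert (HI : forall n, Im (csum u n) = sum_n (fun k => Im (u k)) n).
  { induction n; [now rewrite csum_O, sum_O|]. rewrite csum_S, sum_Sn, <- IHn. reflexivity. }
  assert (L : forall (pr : C -> R), (forall z, Rabs (pr z) <= Cmod z) ->
     (forall z w, pr (z - w)%C = pr z - pr w) ->
     is_lim_seq (fun n => pr (csum u n)) (pr s)).
  { intros pr Hp Hm. apply is_lim_seq_ext with (fun n => pr s + pr (csum u n - s)%C).
    { intros n. rewrite Hm. ring. }
    replace (Finite (pr s)) with (Finite (pr s + 0)) by (f_equal; ring). apply is_lim_seq_plus'; [apply is_lim_seq_const|].
    apply is_lim_seq_abs_0. apply is_lim_seq_le_le with (3 := H) (u := fun _ => 0).
    - intros n; split; [apply Rabs_pos|apply Hp].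
    - apply is_lim_seq_const. }
  rewrite (surjective_pairing s). f_equal; apply is_series_unique.
  - eapply filterlim_ext; [apply HR|]. apply (L Re).
    + apply re_le_Cmod.
    + reflexivity.
  - eapply filterlim_ext; [apply HI|]. apply (L Im).
    + intros z. generalize (Rmax_Cmod z) (Rmax_r (Rabs (fst z)) (Rabs (snd z))). unfold Im; lra.
    + reflexivity.
Qed.

Lemma is_series_finite (u : nat -> C) N : (forall n, (N < n)%nat -> u n = RtoC 0) -> is_series u (csum u N).
Proof.
  intros H. apply is_series_Clim.
  apply is_lim_seq_ext_loc with (fun _ => 0); [|apply is_lim_seq_const].
  exists N. intros n Hn. replace n with (N + (n - N))%nat by lia.
  rewrite csum_extend by auto.
  replace (csum u N - csum u N)%C with (RtoC 0) by ring. now rewrite Cmod_0.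
Qed.

Lemma geometric_sum_bound q n : 0 <= q < 1 -> sum_n (fun k => q ^ k) n <= / (1 - q).
Proof.
  intros Hq. rewrite sum_n_Reals, tech3 by lra.
  assert (0 <= q ^ S n) by (apply pow_le; lra).
  unfold Rdiv. rewrite <- (Rmult_1_l (/ (1 - q))) at 2.
  apply Rmult_le_compat_r; [|lra]. apply Rlt_le, Rinv_0_lt_compat; lra.
Qed.

Lemma ex_series_geometric (u : nat -> C) K q : 0 <= q < 1 ->
  (forall n, Cmod (u n) <= K * q ^ n) -> exists s : C, is_series u s.
Proof.
  intros Hq H.
  apply (@ex_series_le C_AbsRing C_CompleteNormedModule u (fun n => K * q ^ n)).
  - exact H.
  - apply (ex_series_scal (K := R_AbsRing) (V := R_NormedModule) K (fun n => q ^ n)). apply ex_series_geom. rewrite Rabs_pos_eq; lra.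
Qed.

Lemma series_tail_bound (u : nat -> C) (s : C) K q : 0 <= q < 1 -> 0 <= K ->
  (forall n, Cmod (u n) <= K * q ^ n) -> is_series u s ->
  forall n, Cmod (s - csum u n) <= K * q ^ S n / (1 - q).
Proof.
  intros Hq HK H Hs n.
  assert (B : forall p, Cmod (csum u (n + S p) - csum u n) <= K * q ^ S n / (1 - q)).
  { intros p.
    assert (E : (csum u (n + S p) - csum u n)%C = csum (fun k => u (S n + k)%nat) p).
    { induction p.
      - rewrite csum_O, Nat.add_0_r. replace (n + 1)%nat with (S n) by lia. rewrite csum_S. ring.
      - rewrite csum_S, <- IHp, Nat.add_succ_r, csum_S.
        replace (S (n + S p)) with (S n + S p)%nat by lia. ring. }
    rewrite E. eapply Rle_trans; [apply Cmod_csum|].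
    apply Rle_trans with (sum_n (fun k => K * q ^ S n * q ^ k) p).
    - apply sum_n_m_le. intros k. rewrite Rmult_assoc, <- pow_add. apply H.
    - assert (M : sum_n (fun k => K * q ^ S n * q ^ k) p = K * q ^ S n * sum_n (fun k => q ^ k) p)
        by apply (sum_n_mult_l (K := R_Ring)).
      rewrite M. apply Rmult_le_compat_l; [|now apply geometric_sum_bound].
      apply Rmult_le_pos; auto. apply pow_le; lra. }
  apply is_series_Clim in Hs.
  apply (is_lim_seq_incr_n _ (n + 1)) in Hs.
  apply Rnot_lt_le. intros Hlt.
  set (eps := Cmod (s - csum u n) - K * q ^ S n / (1 - q)).
  assert (Heps : 0 < eps) by (unfold eps; lra).
  destruct (proj2 (is_lim_seq_spec _ _) Hs (mkposreal eps Heps)) as [N HN].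
  specialize (HN N (Nat.le_refl N)). simpl in HN.
  rewrite Rminus_0_r, Rabs_pos_eq in HN by apply Cmod_ge_0.
  specialize (B N). replace (N + (n + 1))%nat with (n + S N)%nat in HN by lia.
  set (v := csum u (n + S N)) in *.
  generalize (Cmod_triangle (- (v - s)) (v - csum u n)). rewrite Cmod_opp.
  replace (- (v - s) + (v - csum u n))%C with (s - csum u n)%C by ring.
  unfold eps in HN. lra.
Qed.

Lemma is_lim_seq_n_geom q : 0 < q < 1 -> is_lim_seq (fun n => INR (S n) * q ^ S n) 0.
Proof.
  intros Hq. set (p := (1 + q) / 2). set (h := p / q - 1).
  assert (Hp : 0 < p < 1) by (unfold p; lra).
  assert (Hh : 0 < h).
  { unfold h. assert (1 < p / q); [|lra]. apply Rlt_div_r; unfold p; lra. }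
  apply is_lim_seq_le_le with (fun _ => 0) (fun n => / h * p ^ S n).
  - intros n. split.
    + apply Rmult_le_pos; [apply pos_INR|apply pow_le; lra].
    + generalize (poly (S n) h Hh). replace (1 + h) with (p / q) by (unfold h; ring).
      unfold Rdiv. rewrite Rpow_mult_distr, pow_inv. intros P.
      assert (Q : 0 < q ^ S n) by (apply pow_lt; lra).
      apply Rmult_le_reg_l with (h * / q ^ S n).
      { apply Rmult_lt_0_compat; auto. now apply Rinv_0_lt_compat. }
      replace (h * / q ^ S n * (INR (S n) * q ^ S n)) with (INR (S n) * h) by (field; lra).
      replace (h * / q ^ S n * (/ h * p ^ S n)) with (p ^ S n * / q ^ S n) by (field; lra). lra.
  - apply is_lim_seq_const.
  - rewrite <- (Rmult_0_r (/ h)). apply is_lim_seq_mult'; [apply is_lim_seq_const|].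
    apply (is_lim_seq_incr_1 (fun n => p ^ n)). apply is_lim_seq_geom. rewrite Rabs_pos_eq; lra.
Qed.

Lemma csum_antidiagonal (d : nat -> nat -> C) N :
  csum (fun n => csum (fun k => d k (n - k)%nat) n) N = csum (fun k => csum (d k) (N - k)) N.
Proof.
  induction N.
  - rewrite !csum_O. reflexivity.
  - rewrite csum_S, IHN, (csum_S _ N), (csum_S _ N), Nat.sub_diag, csum_O.
    rewrite Cplus_assoc, <- csum_plus. f_equal. apply csum_ext. intros k Hk.
    replace (S N - k)%nat with (S (N - k)) by lia. now rewrite csum_S.
Qed.

(** Rows and antidiagonals of a geometrically dominated double series have the
    same sum: up to order N they differ by the tails of N+1 rows, each of
    size q^N. *)
Lemma double_series (d : nat -> nat -> C) (r : nat -> C) K q :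
  0 < q < 1 -> 0 <= K -> (forall k j, Cmod (d k j) <= K * q ^ (k + j)) ->
  (forall k, is_series (d k) (r k)) ->
  exists s : C, is_series r s /\ is_series (fun n => csum (fun k => d k (n - k)%nat) n) s.
Proof.
  intros Hq HK Hd Hr.
  assert (Hq' : 0 <= q < 1) by lra.
  assert (Hrow : forall k n, Cmod (r k - csum (d k) n) <= K * q ^ (S (k + n)) / (1 - q)).
  { intros k n. replace (K * q ^ S (k + n)) with ((K * q ^ k) * q ^ S n)
      by (rewrite Rmult_assoc, <- pow_add; do 2 f_equal; lia).
    apply series_tail_bound; auto.
    - apply Rmult_le_pos; auto. apply pow_le; lra.
    - intros j. rewrite Rmult_assoc, <- pow_add. apply Hd. }
  assert (Hinv : 0 < / (1 - q)) by (apply Rinv_0_lt_compat; lra).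
  destruct (ex_series_geometric r (K * (/ (1 - q) + 1)) q Hq') as [s Hs].
  { intros k. specialize (Hrow k 0%nat). rewrite csum_O in Hrow.
    specialize (Hd k 0%nat). rewrite Nat.add_0_r in *.
    generalize (Cmod_triangle (r k - d k 0%nat) (d k 0%nat)).
    replace (r k - d k 0%nat + d k 0%nat)%C with (r k) by ring.
    assert (0 <= q ^ k) by (apply pow_le; lra).
    assert (K * q ^ S k / (1 - q) <= K * q ^ k * / (1 - q)).
    { unfold Rdiv. apply Rmult_le_compat_r; [lra|]. apply Rmult_le_compat_l; auto. simpl; nra. }
    lra. }
  exists s. split; auto.
  apply is_series_Clim in Hs. apply is_series_Clim.
  apply Clim_ext with (fun N => csum r N +
    (csum (fun n => csum (fun k => d k (n - k)%nat) n) N - csum r N))%C; [intros; ring|].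
  rewrite <- (Cplus_0_r s). apply Clim_plus; auto.
  apply Clim_le with (fun N => K / (1 - q) * (INR (S N) * q ^ S N)).
  - intros N. rewrite csum_antidiagonal.
    replace (csum (fun k => csum (d k) (N - k)) N - csum r N - 0)%C
      with (csum (fun k => csum (d k) (N - k) - r k)%C N) by (rewrite csum_minus; ring).
    eapply Rle_trans; [apply Cmod_csum|].
    apply Rle_trans with (sum_n (fun _ => K * q ^ S N / (1 - q)) N).
    + rewrite !sum_n_Reals. apply sum_Rle. intros k Hk.
      rewrite <- Cmod_opp. replace (- (csum (d k) (N - k) - r k))%C with (r k - csum (d k) (N - k))%C by ring.
      eapply Rle_trans; [apply Hrow|]. replace (k + (N - k))%nat with N by lia. lra.
    + rewrite sum_n_const. right. field. lra.
  - rewrite <- (Rmult_0_r (K / (1 - q))). apply is_lim_seq_mult'; [apply is_lim_seq_const|].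
    now apply is_lim_seq_n_geom.
Qed.

Lemma is_series_Cext (u v : nat -> C) (s : C) :
  (forall n, u n = v n) -> is_series u s -> is_series v s.
Proof. exact (is_series_ext u v s). Qed.

Lemma is_series_Cminus (u v : nat -> C) (s t : C) :
  is_series u s -> is_series v t -> is_series (fun n => u n - v n)%C (s - t)%C.
Proof. exact (is_series_minus u v s t). Qed.

Lemma series_bound (u : nat -> C) (s : C) K q : 0 <= q < 1 -> 0 <= K ->
  (forall n, Cmod (u n) <= K * q ^ n) -> is_series u s -> Cmod s <= K / (1 - q).
Proof.
  intros Hq HK H Hs.
  pose proof (series_tail_bound u s K q Hq HK H Hs 0) as T. rewrite csum_O in T.
  specialize (H 0%nat). simpl in T, H.
  generalize (Cmod_triangle (s - u 0%nat) (u 0%nat)).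
  replace (s - u 0%nat + u 0%nat)%C with s by ring.
  replace (K / (1 - q)) with (K * (q * 1) / (1 - q) + K * 1) by (field; lra). lra.
Qed.

(** * Complex powers of positive numbers *)

Lemma Cexp_plus z w : Cexp (z + w) = (Cexp z * Cexp w)%C.
Proof.
  unfold Cexp. destruct z as [a b], w as [c d]. simpl.
  rewrite exp_plus, cos_plus, sin_plus. unfold Cmult; simpl. f_equal; ring.
Qed.

Lemma Cexp_0 : Cexp 0 = 1.
Proof. unfold Cexp; simpl. rewrite exp_0, cos_0, sin_0. unfold RtoC; f_equal; ring. Qed.

Lemma Cmod_Cexp z : Cmod (Cexp z) = exp (Re z).
Proof.
  unfold Cexp, Cmod; simpl fst; simpl snd.
  replace ((exp (Re z) * cos (Im z)) ^ 2 + (exp (Re z) * sin (Im z)) ^ 2)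
    with (exp (Re z) ^ 2 * (Rsqr (sin (Im z)) + Rsqr (cos (Im z)))) by (unfold Rsqr; ring).
  rewrite sin2_cos2, Rmult_1_r. apply sqrt_pow2, Rlt_le, exp_pos.
Qed.

Lemma Cmod_Rcpow r z : Cmod (Rcpow r z) = exp (Re z * ln r).
Proof. unfold Rcpow. rewrite Cmod_Cexp, re_scal_r. reflexivity. Qed.

Lemma Rcpow_neq_0 r z : Rcpow r z <> 0.
Proof. apply Cmod_gt_0. rewrite Cmod_Rcpow. apply exp_pos. Qed.

Lemma Rcpow_plus r z w : Rcpow r (z + w) = (Rcpow r z * Rcpow r w)%C.
Proof. unfold Rcpow. rewrite <- Cexp_plus. f_equal. ring. Qed.

Lemma Rcpow_0 r : Rcpow r 0 = 1.
Proof. unfold Rcpow. rewrite Cmult_0_l. apply Cexp_0. Qed.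

Lemma Rcpow_opp r z : Rcpow r (- z) = (/ Rcpow r z)%C.
Proof.
  assert (H : (Rcpow r z * Rcpow r (- z))%C = 1)
    by (rewrite <- Rcpow_plus, Cplus_opp_r; apply Rcpow_0).
  transitivity (/ Rcpow r z * (Rcpow r z * Rcpow r (- z)))%C.
  - field. apply Rcpow_neq_0.
  - rewrite H. ring.
Qed.

Lemma Rcpow_mult r s z : 0 < r -> 0 < s -> Rcpow (r * s) z = (Rcpow r z * Rcpow s z)%C.
Proof.
  intros Hr Hs. unfold Rcpow. rewrite <- Cexp_plus, ln_mult, RtoC_plus by auto.
  f_equal. ring.
Qed.

Lemma Rcpow_inv r z : 0 < r -> Rcpow (/ r) z = (/ Rcpow r z)%C.
Proof.
  intros Hr. rewrite <- Rcpow_opp. unfold Rcpow. rewrite ln_Rinv, RtoC_opp by auto.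
  f_equal. ring.
Qed.

Lemma Rcpow_div r s z : 0 < r -> 0 < s -> Rcpow (r / s) z = (Rcpow r z / Rcpow s z)%C.
Proof.
  intros Hr Hs. unfold Rdiv. rewrite Rcpow_mult, Rcpow_inv; auto.
  now apply Rinv_0_lt_compat.
Qed.

Lemma Rcpow_1 r : 0 < r -> Rcpow r 1 = RtoC r.
Proof.
  intros Hr. unfold Rcpow, Cexp. rewrite Cmult_1_l. simpl.
  rewrite exp_ln, cos_0, sin_0 by auto. unfold RtoC; f_equal; ring.
Qed.

Lemma Rcpow_nat r n : 0 < r -> Rcpow r (nC n) = (RtoC r ^ n)%C.
Proof.
  intros Hr. induction n.
  - apply Rcpow_0.
  - rewrite nC_S, Rcpow_plus, IHn, Rcpow_1 by auto. simpl; ring.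
Qed.

Lemma Rcpow_one z : Rcpow 1 z = 1.
Proof. unfold Rcpow. rewrite ln_1, Cmult_0_r. apply Cexp_0. Qed.

(** * Derivatives of complex functions of a real variable *)

(** Taken componentwise, as the components are real functions with
    computable derivatives. *)
Definition Cderiv (f : R -> C) (x : R) (l : C) : Prop :=
  is_derive (fun u => Re (f u)) x (Re l) /\ is_derive (fun u => Im (f u)) x (Im l).

Lemma Cderiv_ext f h x l : (forall u, f u = h u) -> Cderiv f x l -> Cderiv h x l.
Proof. intros H [H1 H2]. split; eapply is_derive_ext; eauto; intros; cbv beta; now rewrite H. Qed.

Lemma Cderiv_plus f h x l m :
  Cderiv f x l -> Cderiv h x m -> Cderiv (fun u => f u + h u)%C x (l + m)%C.
Proof.
  intros [H1 H2] [H3 H4]. split.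
  - apply (is_derive_plus (fun u => Re (f u)) (fun u => Re (h u))); auto.
  - apply (is_derive_plus (fun u => Im (f u)) (fun u => Im (h u))); auto.
Qed.

Lemma Cderiv_mult f h x l m :
  Cderiv f x l -> Cderiv h x m -> Cderiv (fun u => f u * h u)%C x (l * h x + f x * m)%C.
Proof.
  intros [H1 H2] [H3 H4].
  pose proof (is_derive_mult _ _ x _ _ H1 H3 Rmult_comm) as P1.
  pose proof (is_derive_mult _ _ x _ _ H2 H4 Rmult_comm) as P2.
  pose proof (is_derive_mult _ _ x _ _ H1 H4 Rmult_comm) as P3.
  pose proof (is_derive_mult _ _ x _ _ H2 H3 Rmult_comm) as P4.
  split; evar_last.
  - exact (is_derive_minus _ _ x _ _ P1 P2).
  - unfold minus, plus, opp, mult; simpl. unfold Re, Im. ring.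
  - exact (is_derive_plus _ _ x _ _ P3 P4).
  - unfold minus, plus, opp, mult; simpl. unfold Re, Im. ring.
Qed.

Lemma Cderiv_const c x : Cderiv (fun _ => c) x 0.
Proof. split; apply (is_derive_const (V := R_NormedModule)). Qed.

Lemma Cderiv_real (f : R -> R) x l : is_derive f x l -> Cderiv (fun u => RtoC (f u)) x (RtoC l).
Proof.
  intros H. split; [exact H|].
  change (is_derive (fun _ : R => 0) x 0). apply (is_derive_const (V := R_NormedModule)).
Qed.

Lemma Cderiv_scal c f x l : Cderiv f x l -> Cderiv (fun u => c * f u)%C x (c * l)%C.
Proof.
  intros H. pose proof (Cderiv_mult (fun _ => c) f x 0 l (Cderiv_const c x) H) as P.
  cbv beta in P. rewrite Cmult_0_l, Cplus_0_l in P. exact P.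
Qed.

Lemma Cderiv_csum (f : nat -> R -> C) (l : nat -> C) x n :
  (forall k, Cderiv (f k) x (l k)) -> Cderiv (fun u => csum (fun k => f k u) n) x (csum l n).
Proof.
  intros H. induction n.
  - apply Cderiv_ext with (f 0%nat); [intros u; symmetry; apply (csum_O (fun k => f k u))|].
    rewrite csum_O. apply H.
  - apply Cderiv_ext with (fun u => csum (fun k => f k u) n + f (S n) u)%C;
      [intros u; symmetry; apply (csum_S (fun k => f k u))|].
    rewrite csum_S. now apply Cderiv_plus.
Qed.

Lemma Cderiv_Rcpow_1m a u : u < 1 ->
  Cderiv (fun u => Rcpow (1 - u) a) u (- a / RtoC (1 - u) * Rcpow (1 - u) a)%C.
Proof.
  intros Hu. destruct a as [p q].
  assert (E : forall v, Rcpow (1 - v) (p, q) =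
    (exp (p * ln (1 - v)) * cos (q * ln (1 - v)), exp (p * ln (1 - v)) * sin (q * ln (1 - v)))).
  { intros v. unfold Rcpow, Cexp. rewrite re_scal_r, im_scal_r. reflexivity. }
  unfold Cdiv. rewrite <- RtoC_inv by lra.
  split.
  - apply is_derive_ext with (fun v => exp (p * ln (1 - v)) * cos (q * ln (1 - v))).
    { intros v. now rewrite E. }
    rewrite E. auto_derive; [lra|]. simpl. unfold Rminus. ring.
  - apply is_derive_ext with (fun v => exp (p * ln (1 - v)) * sin (q * ln (1 - v))).
    { intros v. now rewrite E. }
    rewrite E. auto_derive; [lra|]. simpl. unfold Rminus. ring.
Qed.

Lemma Cmod_mean_value f df M u0 u1 : u0 <= u1 ->
  (forall u, u0 <= u <= u1 -> Cderiv f u (df u) /\ Cmod (df u) <= M) ->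
  Cmod (f u1 - f u0) <= 2 * M * (u1 - u0).
Proof.
  intros Hu H.
  assert (L : forall (pr : C -> R), (forall z, Rabs (pr z) <= Cmod z) ->
     (forall z w, pr (z - w)%C = pr z - pr w) ->
     (forall u, u0 <= u <= u1 -> is_derive (fun v => pr (f v)) u (pr (df u))) ->
     Rabs (pr (f u1 - f u0)%C) <= M * (u1 - u0)).
  { intros pr Hp Hm Hd. rewrite Hm.
    destruct (MVT_gen (fun v => pr (f v)) u0 u1 (fun u => pr (df u))) as (c & Hc & E).
    - rewrite Rmin_left, Rmax_right by auto. intros; apply Hd; lra.
    - rewrite Rmin_left, Rmax_right by auto. intros.
      apply derivable_continuous_pt. exists (pr (df x)). apply is_derive_Reals, Hd; lra.
    - rewrite Rmin_left, Rmax_right in Hc by auto. rewrite E, Rabs_mult, (Rabs_pos_eq (u1 - u0)) by lra.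
      apply Rmult_le_compat_r; [lra|]. eapply Rle_trans; [apply Hp|]. now apply H. }
  assert (HR := L Re re_le_Cmod (fun _ _ => eq_refl) (fun u Hu => proj1 (proj1 (H u Hu)))).
  assert (HI : forall z, Rabs (Im z) <= Cmod z).
  { intros z. generalize (Rmax_Cmod z) (Rmax_r (Rabs (fst z)) (Rabs (snd z))). unfold Im; lra. }
  assert (HJ := L Im HI (fun _ _ => eq_refl) (fun u Hu => proj2 (proj1 (H u Hu)))).
  set (z := (f u1 - f u0)%C) in *.
  assert (Hz : z = (RtoC (Re z) + Ci * RtoC (Im z))%C)
    by (destruct z; unfold Ci, RtoC, Cplus, Cmult; simpl; f_equal; ring).
  rewrite Hz. eapply Rle_trans; [apply Cmod_triangle|].
  rewrite Cmod_mult, Cmod_Ci, !Cmod_R. lra.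
Qed.

(** By (1-u) S' = a S - E the derivative of (1-u)^a S is - (1-u)^(a-1) E, and
    the mean value inequality applies.  When S is a series, only its partial sums
    are differentiated; no limit is exchanged with a derivative. *)
Lemma first_order_invariance (a : C) (Sn dS En : nat -> R -> C) (e : nat -> R) u0 u1 s0 s1 :
  0 <= u0 <= u1 -> u1 < 1 ->
  (forall N u, u0 <= u <= u1 -> Cderiv (Sn N) u (dS N u)) ->
  (forall N u, u0 <= u <= u1 ->
     (RtoC (1 - u) * dS N u = a * Sn N u - En N u)%C /\ Cmod (En N u) <= e N) ->
  is_lim_seq e 0 ->
  Clim (fun N => Sn N u0) s0 -> Clim (fun N => Sn N u1) s1 ->
  (Rcpow (1 - u0) a * s0 = Rcpow (1 - u1) a * s1)%C.
Proof.
  intros H0 H1 Hd HE He L0 L1.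
  set (B := exp (Rabs (Re (a - 1)%C) * - ln (1 - u1))).
  assert (HV : forall N, Cmod (Rcpow (1 - u1) a * Sn N u1 - Rcpow (1 - u0) a * Sn N u0)
      <= 2 * (B * e N) * (u1 - u0)).
  { intros N. apply (Cmod_mean_value (fun u => Rcpow (1 - u) a * Sn N u)%C
      (fun u => - (Rcpow (1 - u) (a - 1) * En N u))%C); [lra|].
    intros u Hu. destruct (HE N u Hu) as [E1 E2].
    assert (Hu1 : RtoC (1 - u) <> RtoC 0) by (intros E; apply RtoC_inj in E; lra).
    assert (Ea : Rcpow (1 - u) a = (Rcpow (1 - u) (a - 1) * RtoC (1 - u))%C).
    { rewrite <- (Rcpow_1 (1 - u)) by lra. rewrite <- Rcpow_plus. f_equal. ring. }
    split.
    - replace (- (Rcpow (1 - u) (a - 1) * En N u))%C with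
        (- a / RtoC (1 - u) * Rcpow (1 - u) a * Sn N u + Rcpow (1 - u) a * dS N u)%C.
      + apply (Cderiv_mult (fun u => Rcpow (1 - u) a)); [apply Cderiv_Rcpow_1m; lra|auto].
      + replace (En N u) with (a * Sn N u - RtoC (1 - u) * dS N u)%C by (rewrite E1; ring).
        rewrite Ea. field. auto.
    - rewrite Cmod_opp, Cmod_mult. apply Rmult_le_compat; try apply Cmod_ge_0; auto.
      rewrite Cmod_Rcpow. unfold B.
      assert (Hln : ln (1 - u1) <= ln (1 - u) <= 0).
      { split; [apply ln_le; lra|]. rewrite <- ln_1. apply ln_le; lra. }
      assert (Hle : Re (a - 1) * ln (1 - u) <= Rabs (Re (a - 1)%C) * - ln (1 - u1)).
      { generalize (Rle_abs (- Re (a - 1)%C)) (Rabs_pos (Re (a - 1)%C)).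
        rewrite Rabs_Ropp. intros. nra. }
      destruct Hle as [Hle| ->]; [left; now apply exp_increasing|right; reflexivity]. }
  symmetry.
  apply Clim_unique with (fun N => Rcpow (1 - u1) a * Sn N u1)%C.
  - now apply Clim_mult_l.
  - apply Clim_ext with (fun N => Rcpow (1 - u0) a * Sn N u0 +
        (Rcpow (1 - u1) a * Sn N u1 - Rcpow (1 - u0) a * Sn N u0))%C; [intros; ring|].
    rewrite <- (Cplus_0_r (_ * s0)). apply Clim_plus; [now apply Clim_mult_l|].
    apply Clim_le with (fun N => 2 * (B * e N) * (u1 - u0)).
    + intros N. unfold Cminus at 1. rewrite Copp_0, Cplus_0_r. apply HV.
    + apply is_lim_seq_ext with (fun N => 2 * B * (u1 - u0) * e N); [intros; ring|].
      rewrite <- (Rmult_0_r (2 * B * (u1 - u0))).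
      now apply is_lim_seq_mult'; [apply is_lim_seq_const|].
Qed.

(** A few factors q^n with q close to 1 do not destroy geometric convergence. *)
Lemma room_for_subexponential r : 0 < r < 1 -> exists q, 1 < q /\ 0 < q ^ 4 * r < 1.
Proof.
  intros Hr. exists (1 + (1 - r) / 16). set (h := (1 - r) / 16).
  assert (Hh : 0 < h < 1) by (unfold h; lra).
  assert (H4 : 1 < (1 + h) ^ 4 <= 1 + 15 * h).
  { split; [apply Rlt_pow_R1; lra || lia|]. assert (h ^ 2 <= h) by nra.
    assert (h ^ 3 <= h) by nra. assert (h ^ 4 <= h) by nra. nra. }
  split; [lra|]. assert (r = 1 - 16 * h) by (unfold h; lra). nra.
Qed.

(** * The binomial series and Pfaff's transformation *)

(** The partial sums satisfy (1-u) S' = a S - (a+N) e_N u^N, where e_N is the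
    last coefficient. *)
Lemma binomial_series (a : C) v : 0 <= v < 1 ->
  is_series (fun n => pochhammer a n / nC (fact n) * RtoC v ^ n)%C (Rcpow (1 - v) (- a)).
Proof.
  intros Hv.
  set (e := fun n => (pochhammer a n / nC (fact n))%C).
  assert (He : forall n, ((nC n + 1) * e (S n) = (a + nC n) * e n)%C).
  { intros n. unfold e. rewrite poch_S, fact_S. field. nz. }
  set (v' := (1 + v) / 2). assert (Hv' : 0 < v' < 1 /\ v <= v') by (unfold v'; lra).
  destruct (room_for_subexponential v') as (q & Hq & Hqv); [lra|].
  assert (Hqv' : 0 <= q * v' < 1).
  { split; [nra|]. assert (q * 1 <= q * q ^ 3) by (apply Rmult_le_compat_l; [lra|apply pow_ge_1; lra]).
    simpl in *. nra. }
  destruct (poch_ratio_bound (a + 1) 1 q (nonpole_pos 1 Rlt_0_1) Hq) as (K & HK & HB).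
  destruct (poch_ratio_bound a 1 q (nonpole_pos 1 Rlt_0_1) Hq) as (K' & HK' & HB').
  assert (Hpow : forall k u n, 0 <= k -> 0 <= u <= v -> k * q ^ n * u ^ n <= k * (q * v') ^ n).
  { intros k u n Hk Hu. rewrite Rpow_mult_distr, <- Rmult_assoc.
    apply Rmult_le_compat_l; [apply Rmult_le_pos; auto; apply pow_le; lra|].
    apply pow_incr; lra. }
  destruct (ex_series_geometric (fun n => e n * RtoC v ^ n)%C K' (q * v') Hqv') as [s Hs].
  { intros n. specialize (HB' n). rewrite poch_one in HB'. fold (e n) in HB'.
    rewrite Cmod_mult, Cmod_pow, Cmod_R, Rabs_pos_eq by lra.
    eapply Rle_trans; [|apply (Hpow K' v); lra].
    apply Rmult_le_compat_r; auto. apply pow_le; lra. }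
  replace (Rcpow (1 - v) (- a)) with s; auto.
  assert (E : (Rcpow (1 - 0) a * 1 = Rcpow (1 - v) a * s)%C).
  { apply (first_order_invariance a
      (fun N u => csum (fun n => e n * RtoC (u ^ n))%C N)
      (fun N u => csum (fun n => e n * RtoC (INR n * u ^ pred n))%C N)
      (fun N u => (a + nC N) * e N * RtoC (u ^ N))%C
      (fun N => Cmod a * K * (q * v') ^ N)); try lra.
    - intros N u Hu. apply (Cderiv_csum (fun n u => e n * RtoC (u ^ n))%C). intros n.
      apply (Cderiv_scal (e n) (fun u => RtoC (u ^ n))), Cderiv_real.
      auto_derive; auto. simpl. ring.
    - intros N u Hu. split.
      + induction N.
        * rewrite !csum_O. simpl. rewrite Rmult_0_l. ring.
        * rewrite !csum_S, Cmult_plus_distr_l, IHN. simpl pred.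
          rewrite !RtoC_mult, nC_S, RtoC_minus, <- He. simpl pow. rewrite RtoC_mult.
          ring.
      + assert (Ea : ((a + nC N) * e N = a * (pochhammer (a + 1) N / pochhammer 1 N))%C).
        { unfold e. rewrite poch_one.
          transitivity (pochhammer a (S N) / nC (fact N))%C; [rewrite poch_S|rewrite poch_Sl]; field; nz. }
        rewrite Ea, !Cmod_mult, Cmod_R, Rabs_pos_eq by (apply pow_le; lra).
        eapply Rle_trans; [|apply (Hpow (Cmod a * K) u); try lra; apply Rmult_le_pos; auto using Cmod_ge_0].
        apply Rmult_le_compat_r; [apply pow_le; lra|].
        rewrite Rmult_assoc. apply Rmult_le_compat_l; [apply Cmod_ge_0|apply HB].
    - rewrite <- (Rmult_0_r (Cmod a * K)). apply is_lim_seq_mult'; [apply is_lim_seq_const|].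
      apply is_lim_seq_geom. rewrite Rabs_pos_eq; lra.
    - apply Clim_ext with (fun _ => RtoC 1).
      + intros N. induction N.
        * rewrite csum_O. unfold e. simpl. field.
        * rewrite csum_S, <- IHN. simpl pow. rewrite Rmult_0_l. ring.
      + apply Clim_le with (fun _ => 0); [|apply is_lim_seq_const].
        intros n. replace (1 - 1)%C with (RtoC 0) by ring. rewrite Cmod_0; lra.
    - apply is_series_Clim in Hs. revert Hs. apply Clim_ext. intros N. apply csum_ext.
      intros n _. now rewrite RtoC_pow. }
  rewrite Rminus_0_r, Rcpow_one, Cmult_1_l in E.
  rewrite Rcpow_opp. transitivity (/ Rcpow (1 - v) a * (Rcpow (1 - v) a * s))%C.
  - field. apply Rcpow_neq_0.
  - rewrite <- E. ring.
Qed.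

Lemma fact_plus_le k : forall j, INR (fact (k + j)) <= 2 ^ (k + j) * INR (fact k) * INR (fact j).
Proof.
  assert (H0 : forall n, INR (fact n) <= 2 ^ n * INR (fact n)).
  { intros n. generalize (pow_ge_1 2 n ltac:(lra)) (pos_INR (fact n)). nra. }
  induction k as [|k IHk]; intros j.
  - simpl (INR (fact 0)). rewrite Rmult_1_r. apply H0.
  - induction j as [|j IHj].
    + rewrite Nat.add_0_r. simpl (INR (fact 0)). rewrite Rmult_1_r. apply H0.
    + specialize (IHk (S j)).
      replace (S k + S j)%nat with (S (S (k + j))) in * by lia.
      replace (k + S j)%nat with (S (k + j)) in * by lia.
      replace (S k + j)%nat with (S (k + j)) in * by lia.
      set (n := S (k + j)) in *.
      rewrite (fact_simpl n), mult_INR.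
      rewrite (fact_simpl k), (fact_simpl j), !mult_INR in *.
      replace (INR (S n)) with (INR (S k) + INR (S j)) by (rewrite <- plus_INR; f_equal; unfold n; lia).
      apply (Rmult_le_compat_l (INR (S k))) in IHk; [|apply pos_INR].
      apply (Rmult_le_compat_l (INR (S j))) in IHj; [|apply pos_INR].
      change (2 ^ S n) with (2 * 2 ^ n). lra.
Qed.

Lemma hyp2F1_is_series a b c z : nonpole c -> 0 < Cmod z < 1 ->
  is_series (fun n => pochhammer a n * pochhammer b n
      / (pochhammer c n * nC (fact n)) * z ^ n)%C (hyp2F1 a b c z).
Proof.
  intros Hc Hz.
  destruct (room_for_subexponential (Cmod z) Hz) as (q & Hq & Hqz).
  destruct (poch_ratio_bound a 1 q (nonpole_pos 1 Rlt_0_1) Hq) as (K1 & HK1 & B1).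
  destruct (poch_ratio_bound b c q Hc Hq) as (K2 & HK2 & B2).
  destruct (ex_series_geometric (fun n => pochhammer a n * pochhammer b n
      / (pochhammer c n * nC (fact n)) * z ^ n)%C (K1 * K2) (q ^ 4 * Cmod z)) as [s Hs].
  - lra.
  - intros n. specialize (B1 n). specialize (B2 n). rewrite poch_one in B1.
    replace (pochhammer a n * pochhammer b n / (pochhammer c n * nC (fact n)) * z ^ n)%C
      with ((pochhammer a n / nC (fact n)) * (pochhammer b n / pochhammer c n) * z ^ n)%C
      by (field; nz).
    rewrite !Cmod_mult, Cmod_pow, Rpow_mult_distr, <- Rmult_assoc.
    apply Rmult_le_compat_r; [apply pow_le, Cmod_ge_0|].
    apply Rle_trans with ((K1 * q ^ n) * (K2 * q ^ n)).
    + apply Rmult_le_compat; auto using Cmod_ge_0.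
    + replace (K1 * q ^ n * (K2 * q ^ n)) with (K1 * K2 * q ^ (n + n)) by (rewrite pow_add; ring).
      apply Rmult_le_compat_l; [now apply Rmult_le_pos|].
      rewrite <- pow_mult. apply Rle_pow; [lra|lia].
  - unfold hyp2F1. now rewrite (CSeries_unique _ _ Hs).
Qed.

(** Expanding (1-v)^(-a-k) by the binomial theorem turns the right-hand side
    into a double series, whose antidiagonals are Chu--Vandermonde sums. *)
Lemma pfaff_transformation (a b c : C) v : nonpole c -> 0 < v < 1 / 2 ->
  hyp2F1 a b c (RtoC v)
  = (Rcpow (1 - v) (- a) * hyp2F1 a (c - b) c (- RtoC (v / (1 - v))))%C.
Proof.
  intros Hc Hv.
  set (d := fun k j => (pochhammer a (k + j) * pochhammer (c - b) k * (-(1)) ^ k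
    / (pochhammer c k * nC (fact k) * nC (fact j)) * RtoC v ^ (k + j))%C).
  set (r := fun k => (Rcpow (1 - v) (- a) * (pochhammer a k * pochhammer (c - b) k
     / (pochhammer c k * nC (fact k)) * (- RtoC (v / (1 - v))) ^ k))%C).
  assert (Hv1 : RtoC (1 - v) <> RtoC 0) by (intros E; apply RtoC_inj in E; lra).
  assert (Hrow : forall k, is_series (d k) (r k)).
  { intros k. pose proof (binomial_series (a + nC k) v ltac:(lra)) as B.
    apply (is_series_Cmult_l (pochhammer a k * pochhammer (c - b) k * (-(1)) ^ k
       / (pochhammer c k * nC (fact k)) * RtoC v ^ k)%C) in B.
    replace (r k) with (pochhammer a k * pochhammer (c - b) k * (-(1)) ^ k
       / (pochhammer c k * nC (fact k)) * RtoC v ^ k * Rcpow (1 - v) (- (a + nC k)))%C.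
    - revert B. apply is_series_Cext. intros j. unfold d.
      rewrite poch_add, Cpow_add_r. field. nz.
    - unfold r. replace (- (a + nC k))%C with (- a + - nC k)%C by ring.
      rewrite Rcpow_plus, (Rcpow_opp _ (nC k)), Rcpow_nat by lra.
      replace (- RtoC (v / (1 - v)))%C with (-(1) * (RtoC v * / RtoC (1 - v)))%C
        by (rewrite RtoC_div by lra; unfold Cdiv; ring).
      rewrite !Cpow_mult_l, Cpow_inv by auto. field. nz. now apply Cpow_nz. }
  destruct (room_for_subexponential (2 * v)) as (q & Hq & Hqv); [lra|].
  destruct (poch_ratio_bound a 1 q (nonpole_pos 1 Rlt_0_1) Hq) as (K1 & HK1 & B1).
  destruct (poch_ratio_bound (c - b) c q Hc Hq) as (K2 & HK2 & B2).
  destruct (double_series d r (K1 * K2) (q ^ 4 * (2 * v))) as (s & Hs1 & Hs2); auto.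
  { now apply Rmult_le_pos. }
  { intros k j. unfold d.
    replace (pochhammer a (k + j) * pochhammer (c - b) k * (-(1)) ^ k
       / (pochhammer c k * nC (fact k) * nC (fact j)) * RtoC v ^ (k + j))%C
     with ((pochhammer a (k + j) / nC (fact (k + j))) * (pochhammer (c - b) k / pochhammer c k)
       * (nC (fact (k + j)) / (nC (fact k) * nC (fact j)) * RtoC v ^ (k + j)) * (-(1)) ^ k)%C
     by (field; nz).
    rewrite !Cmod_mult, (Cmod_pow (-(1))), Cmod_m1, pow1, Rmult_1_r.
    rewrite (Cmod_div (nC (fact (k + j))) (_ * _)), (Cmod_mult (nC (fact k))), !Cmod_nC, Cmod_pow, Cmod_R, Rabs_pos_eq
      by (lra || apply Cmult_neq_0; apply fact_nC_neq_0).
    specialize (B1 (k + j)%nat). rewrite poch_one in B1. specialize (B2 k).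
    assert (Q : q ^ (k + j) * q ^ k <= (q ^ 4) ^ (k + j)).
    { rewrite <- pow_add, <- pow_mult. apply Rle_pow; [lra|lia]. }
    assert (F : INR (fact (k + j)) / (INR (fact k) * INR (fact j)) <= 2 ^ (k + j)).
    { apply Rle_div_l; [apply Rlt_gt, Rmult_lt_0_compat; apply INR_fact_lt_0|].
      rewrite <- Rmult_assoc. apply fact_plus_le. }
    assert (F0 : 0 <= INR (fact (k + j)) / (INR (fact k) * INR (fact j))).
    { apply Rle_div_r; [apply Rlt_gt, Rmult_lt_0_compat; apply INR_fact_lt_0|].
      rewrite Rmult_0_l. apply pos_INR. }
    assert (V : 0 <= v ^ (k + j)) by (apply pow_le; lra).
    rewrite !Rpow_mult_distr.
    apply Rle_trans with ((K1 * K2) * (q ^ (k + j) * q ^ k) * (2 ^ (k + j) * v ^ (k + j))).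
    - apply Rmult_le_compat.
      + apply Rmult_le_pos; apply Cmod_ge_0.
      + now apply Rmult_le_pos.
      + apply Rle_trans with ((K1 * q ^ (k + j)) * (K2 * q ^ k)); [|right; ring].
        apply Rmult_le_compat; auto using Cmod_ge_0.
      + now apply Rmult_le_compat_r.
    - rewrite <- (Rmult_assoc (K1 * K2) ((q ^ 4) ^ (k + j))). apply Rmult_le_compat_r.
      + apply Rmult_le_pos; auto. apply pow_le; lra.
      + apply Rmult_le_compat_l; auto. now apply Rmult_le_pos. }
  assert (E1 : hyp2F1 a b c (RtoC v) = s).
  { apply CSeries_unique. revert Hs2. apply is_series_Cext. intros n. unfold d.
    rewrite (csum_ext _ (fun k => pochhammer a n * RtoC v ^ n * ((-(1)) ^ k * rfact n k * pochhammer (c - b) k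
                 / (pochhammer c k * nC (fact k))))%C).
    2:{ intros k Hk. replace (k + (n - k))%nat with n by lia. rewrite rfact_le by auto. field. nz. }
    rewrite csum_mult_l, chu_vandermonde by auto.
    replace (c - (c - b))%C with b by ring. field. nz. }
  rewrite E1. apply is_series_C_unique with r; auto.
  apply is_series_Cmult_l, hyp2F1_is_series; auto.
  rewrite Cmod_opp, Cmod_R, Rabs_pos_eq.
  - split; [apply Rdiv_lt_0_compat|apply Rlt_div_l]; lra.
  - apply Rlt_le, Rdiv_lt_0_compat; lra.
Qed.

(** * The generating function *)

Lemma gpoly_series_ex a c rho y : nonpole c -> 0 < rho < 1 -> 0 <= y <= 1 ->
  exists s : C, is_series (fun n => RtoC rho ^ n * gpoly a c n (RtoC y))%C s.
Proof.
  intros Hc Hr Hy. destruct (room_for_subexponential rho Hr) as (q & Hq & Hqr).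
  destruct (gpoly_bound a c (q ^ 4) Hc) as (K & HK & HB); [apply Rlt_pow_R1; lra || lia|].
  apply ex_series_geometric with K (q ^ 4 * rho); [lra|].
  intros n. rewrite Cmod_mult, Cmod_pow, Cmod_R, Rabs_pos_eq by lra.
  rewrite Rpow_mult_distr, <- Rmult_assoc, Rmult_comm.
  apply Rmult_le_compat_r; [apply pow_le; lra|]. now apply HB.
Qed.

Lemma gpoly_series_at_1 a c rho : nonpole c -> 0 < rho < 1 ->
  is_series (fun n => RtoC rho ^ n * gpoly a c n 1)%C (hyp2F1 a (a - c + 1) c (- RtoC rho)).
Proof.
  intros Hc Hr. destruct (gpoly_series_ex a c rho 1 Hc Hr ltac:(lra)) as [s Hs].
  replace (hyp2F1 a (a - c + 1) c (- RtoC rho)) with s; auto.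
  symmetry. apply CSeries_unique. revert Hs. apply is_series_Cext. intros n.
  rewrite gpoly_1 by auto. replace (- RtoC rho)%C with (-(1) * RtoC rho)%C by ring.
  rewrite Cpow_mult_l. field. nz.
Qed.

Lemma curve_monomial_derive n m w u : 0 < w -> 0 < u < 1 ->
  is_derive (fun u => u ^ n * (w * (1 - u) ^ 2 / u) ^ m) u
    (u ^ n * (w * (1 - u) ^ 2 / u) ^ m * (INR n * (1 - u) - INR m * (1 + u)) / (u * (1 - u))).
Proof.
  intros Hw Hu.
  assert (P : forall k z, z <> 0 -> INR k * z ^ pred k = INR k * z ^ k / z).
  { intros [|k] z Hz; [simpl; field; auto|]. simpl pred. simpl pow. field; auto. }
  assert (Hz : w * (1 - u) ^ 2 / u <> 0).
  { apply Rgt_not_eq, Rdiv_lt_0_compat; [|lra]. apply Rmult_lt_0_compat; auto. apply pow_lt; lra. }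
  evar_last.
  - apply (is_derive_mult (fun u => u ^ n) (fun u => (w * (1 - u) ^ 2 / u) ^ m) u
      (INR n * u ^ pred n) (INR m * (w * (1 - u) ^ 2 / u) ^ pred m * (- (w * (1 - u) ^ 2 / u) * (1 + u) / (u * (1 - u))))).
    + auto_derive; auto. ring.
    + evar_last.
      * apply (is_derive_pow (fun u => w * (1 - u) ^ 2 / u) m u (- (w * (1 - u) ^ 2 / u) * (1 + u) / (u * (1 - u)))).
        auto_derive; [lra|]. field. lra.
      * unfold mult; simpl. ring.
    + exact Rmult_comm.
  - unfold plus, mult; simpl. rewrite !P by (auto; lra).
    set (z := w * (1 - u) ^ 2 / u) in *. field. repeat split; auto; lra.
Qed.

(** Euler's operator y d/dy applied to [gpoly]. *)
Definition gpoly_euler (a c : C) (n : nat) (y : C) : C :=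
  csum (fun m => nC m * (gcoef a c n m * y ^ m))%C n.

Lemma gpoly_euler_S a c n y : nonpole c ->
  gpoly_euler a c (S n) y = (- a * (a + 1) / c * y * gpoly (a + 2) (c + 1) n y)%C.
Proof.
  intros Hc. unfold gpoly_euler. rewrite csum_shift. simpl (INR 0).
  rewrite Cmult_0_l, Cplus_0_l.
  unfold gpoly. rewrite <- csum_mult_l. apply csum_ext. intros m _.
  rewrite Cmult_assoc, gcoef_derive by auto. simpl Cpow. ring.
Qed.

Lemma gpoly_euler_rec a c n y :
  ((nC n + 1) * gpoly a c (S n) y - gpoly_euler a c (S n) y
   = (a + nC n) * gpoly a c n y + gpoly_euler a c n y)%C.
Proof.
  rewrite (gpoly_extend a c n (S n)) by lia.
  unfold gpoly_euler at 2.
  rewrite <- (csum_extend _ n 1) by (intros m Hm; rewrite gcoef_gt by auto; ring).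
  rewrite Nat.add_1_r. unfold gpoly, gpoly_euler.
  rewrite <- !csum_mult_l, <- csum_minus, <- csum_plus. apply csum_ext. intros m _.
  transitivity (((nC n + 1 - nC m) * gcoef a c (S n) m) * y ^ m)%C; [ring|].
  rewrite gcoef_step. ring.
Qed.

(** For G(u,y) = sum u^n g_n(y), [gpoly_euler_rec] is the equation
    (1-u) u G_u = (1+u) y G_y + a u G.  Its characteristics are the curves
    y = w (1-u)^2 / u, along which (1-u)^a G is constant.  They lead from
    (rho,y) down to a point (r,1) without leaving 0 <= y <= 1; the power series
    in y, in contrast, need not converge at the given point. *)
Lemma gpoly_series_transport a c rho y r s0 s1 :
  nonpole c -> 0 < r <= rho -> rho < 1 -> r * (1 - rho) ^ 2 = rho * y * (1 - r) ^ 2 ->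
  is_series (fun n => RtoC r ^ n * gpoly a c n 1)%C s0 ->
  is_series (fun n => RtoC rho ^ n * gpoly a c n (RtoC y))%C s1 ->
  (Rcpow (1 - r) a * s0 = Rcpow (1 - rho) a * s1)%C.
Proof.
  intros Hc Hr Hrho Hy Hs0 Hs1.
  set (w := r / (1 - r) ^ 2).
  assert (Hr2 : 0 < (1 - r) ^ 2) by (apply pow_lt; lra).
  assert (Hw : 0 < w) by (apply Rdiv_lt_0_compat; lra).
  set (Y := fun u => w * (1 - u) ^ 2 / u).
  assert (HYr : Y r = 1) by (unfold Y, w; field; lra).
  assert (HYrho : Y rho = y).
  { unfold Y, w. replace (r / (1 - r) ^ 2 * (1 - rho) ^ 2 / rho)
      with (r * (1 - rho) ^ 2 / ((1 - r) ^ 2 * rho)) by (field; lra).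
    rewrite Hy. field. lra. }
  assert (HY : forall u, r <= u <= rho -> 0 <= Y u <= 1).
  { intros u Hu. unfold Y, w. split.
    - apply Rle_div_r; [lra|]. rewrite Rmult_0_l. apply Rmult_le_pos; [apply Rlt_le, Hw|].
      apply pow_le; lra.
    - replace (r / (1 - r) ^ 2 * (1 - u) ^ 2 / u) with (r * (1 - u) ^ 2 / (u * (1 - r) ^ 2)) by (field; lra).
      apply Rle_div_l; [apply Rmult_lt_0_compat; lra|]. rewrite Rmult_1_l.
      apply Rmult_le_compat; try lra; [apply pow_le; lra|]. apply pow_incr; lra. }
  assert (Hrr : 0 < rho < 1) by lra.
  destruct (room_for_subexponential rho Hrr) as (q & Hq & Hqr).
  assert (Hq4 : 1 < q ^ 4) by (apply Rlt_pow_R1; lra || lia).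
  set (p := q ^ 4) in *.
  destruct (gpoly_bound a c p Hc Hq4) as (K1 & HK1 & B1).
  destruct (gpoly_bound (a + 2) (c + 1) p (nonpole_S c Hc) Hq4) as (K2 & HK2 & B2).
  set (M := Cmod (- a * (a + 1) / c)).
  assert (HM : 0 <= M) by apply Cmod_ge_0.
  apply (first_order_invariance a
    (fun N u => csum (fun n => csum (fun m => gcoef a c n m * RtoC (u ^ n * Y u ^ m)) n) N)%C
    (fun N u => csum (fun n => csum (fun m => gcoef a c n m *
         RtoC (u ^ n * Y u ^ m * (INR n * (1 - u) - INR m * (1 + u)) / (u * (1 - u)))) n) N)%C
    (fun N u => ((nC N + 1) * gpoly a c (S N) (RtoC (Y u)) - gpoly_euler a c (S N) (RtoC (Y u))) * RtoC (u ^ N))%C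
    (fun N => K1 / rho * (INR (S N) * (p * rho) ^ S N) + M * K2 * (p * rho) ^ N)); try lra.
  - intros N u Hu.
    apply (Cderiv_csum (fun n u => csum (fun m => gcoef a c n m * RtoC (u ^ n * Y u ^ m)) n)%C).
    intros n. apply (Cderiv_csum (fun m u => gcoef a c n m * RtoC (u ^ n * Y u ^ m))%C). intros m.
    apply (Cderiv_scal _ (fun u => RtoC (u ^ n * Y u ^ m))), Cderiv_real.
    apply curve_monomial_derive; lra.
  - intros N u Hu.
    assert (Hu0 : RtoC u <> RtoC 0) by (intros E; apply RtoC_inj in E; lra).
    assert (Hu1 : RtoC (1 - u) <> RtoC 0) by (intros E; apply RtoC_inj in E; lra).
    split.
    + set (z := RtoC (Y u)).
      assert (HS : forall n, csum (fun m => gcoef a c n m * RtoC (u ^ n * Y u ^ m))%C n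
                 = (RtoC u ^ n * gpoly a c n z)%C).
      { intros n. unfold gpoly. rewrite <- csum_mult_l. apply csum_ext. intros m _.
        unfold z. rewrite RtoC_mult, !RtoC_pow. ring. }
      assert (HD : forall n, csum (fun m => gcoef a c n m *
         RtoC (u ^ n * Y u ^ m * (INR n * (1 - u) - INR m * (1 + u)) / (u * (1 - u))))%C n
         = (RtoC u ^ n / (RtoC u * RtoC (1 - u)) *
             (nC n * RtoC (1 - u) * gpoly a c n z - RtoC (1 + u) * gpoly_euler a c n z))%C).
      { intros n. unfold gpoly, gpoly_euler.
        rewrite <- !csum_mult_l, <- csum_minus, <- csum_mult_l. apply csum_ext. intros m _.
        unfold z. rewrite RtoC_div by (apply Rmult_integral_contrapositive; lra).
        rewrite !RtoC_mult, (RtoC_minus (INR n * (1 - u))), !RtoC_mult, !RtoC_pow. field. auto. }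
      induction N.
      * rewrite !(csum_O (fun n => csum _ n)), HS, HD.
        rewrite gpoly_euler_rec. unfold gpoly_euler. rewrite csum_O. simpl. field. auto.
      * rewrite !(csum_S (fun n => csum _ n)), HS, HD, Cmult_plus_distr_l, IHN.
        rewrite (gpoly_euler_rec a c (S N)), nC_S, !RtoC_pow. simpl Cpow.
        rewrite RtoC_minus, RtoC_plus in *. field. auto.
    + rewrite Cmod_mult, Cmod_R, Rabs_pos_eq by (apply pow_le; lra).
      specialize (HY u Hu).
      assert (T : Cmod ((nC N + 1) * gpoly a c (S N) (RtoC (Y u)) - gpoly_euler a c (S N) (RtoC (Y u)))
         <= INR (S N) * (K1 * p ^ S N) + M * (K2 * p ^ N)).
      { eapply Rle_trans; [apply Cmod_triangle|]. rewrite Cmod_opp.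
        apply Rplus_le_compat.
        - rewrite Cmod_mult, <- nC_S, Cmod_nC. apply Rmult_le_compat_l; [apply pos_INR|]. now apply B1.
        - rewrite gpoly_euler_S, !Cmod_mult by auto. fold M.
          rewrite (Cmod_R (Y u)), Rabs_pos_eq by lra.
          rewrite Rmult_assoc. apply Rmult_le_compat_l; auto.
          specialize (B2 N (Y u) HY). pose proof (Cmod_ge_0 (gpoly (a + 2) (c + 1) N (RtoC (Y u)))). nra. }
      assert (U : 0 <= u ^ N <= rho ^ N) by (split; [apply pow_le; lra|apply pow_incr; lra]).
      assert (T0 : 0 <= INR (S N) * (K1 * p ^ S N) + M * (K2 * p ^ N)) by (eapply Rle_trans; [apply Cmod_ge_0|apply T]).
      apply Rle_trans with ((INR (S N) * (K1 * p ^ S N) + M * (K2 * p ^ N)) * rho ^ N).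
      * apply Rmult_le_compat; try lra. apply Cmod_ge_0.
      * right. rewrite !Rpow_mult_distr. simpl pow. field. lra.
  - rewrite <- (Rplus_0_r 0) at 1.
    replace (Finite (0 + 0)) with (Finite (K1 / rho * 0 + M * K2 * 0)) by (f_equal; ring).
    apply is_lim_seq_plus'; apply is_lim_seq_mult'; try apply is_lim_seq_const.
    + apply is_lim_seq_n_geom; lra.
    + apply is_lim_seq_geom. rewrite Rabs_pos_eq; lra.
  - apply is_series_Clim in Hs0. revert Hs0. apply Clim_ext. intros N. apply csum_ext. intros n _.
    rewrite HYr. unfold gpoly. rewrite <- csum_mult_l. apply csum_ext. intros m _.
    rewrite pow1, Rmult_1_r, RtoC_pow, Cpow_1_l. ring.
  - apply is_series_Clim in Hs1. revert Hs1. apply Clim_ext. intros N. apply csum_ext. intros n _.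
    rewrite HYrho. unfold gpoly. rewrite <- csum_mult_l. apply csum_ext. intros m _.
    rewrite RtoC_mult, !RtoC_pow. ring.
Qed.

(** * The Gamma function at real arguments *)

Definition gamma_density (p t : R) : R := exp ((p - 1) * ln t) * exp (- t).

Lemma gamma_density_pos p t : 0 < gamma_density p t.
Proof. apply Rmult_lt_0_compat; apply exp_pos. Qed.

Lemma gamma_density_continuous p t : 0 < t -> continuous (gamma_density p) t.
Proof.
  intros Ht. apply (ex_derive_continuous (V := R_NormedModule)).
  unfold gamma_density. auto_derive. auto.
Qed.

Lemma gamma_density_ex_RInt p a b : 0 < a -> 0 < b -> ex_RInt (gamma_density p) a b.
Proof.
  intros Ha Hb. apply (ex_RInt_continuous (V := R_CompleteNormedModule)).
  intros t Ht. apply gamma_density_continuous.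
  apply Rlt_le_trans with (2 := proj1 Ht). now apply Rmin_glb_lt.
Qed.

(** Euler's integral as a relation, since its convergence is proved together
    with its functional equation. *)
Definition is_gamma (p l : R) : Prop :=
  is_RInt_gen (gamma_density p) (at_right 0) (Rbar_locally p_infty) l.

Lemma gamma_density_parts p a b : 0 < a -> 0 < b ->
  RInt (gamma_density (p + 1)) a b
  = p * RInt (gamma_density p) a b
    - (exp (p * ln b) * exp (- b) - exp (p * ln a) * exp (- a)).
Proof.
  intros Ha Hb.
  assert (D : is_RInt (fun t => p * gamma_density p t - gamma_density (p + 1) t) a b
     (exp (p * ln b) * exp (- b) - exp (p * ln a) * exp (- a))).
  { assert (Hm : forall t, Rmin a b <= t <= Rmax a b -> 0 < t).
    { intros t Ht. apply Rlt_le_trans with (2 := proj1 Ht). now apply Rmin_glb_lt. }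
    apply (is_RInt_derive (V := R_CompleteNormedModule) (fun t => exp (p * ln t) * exp (- t))).
    - intros t Ht. specialize (Hm t Ht). unfold gamma_density. auto_derive; auto.
      replace (p + 1 - 1) with p by ring.
      replace (exp (p * ln t)) with (exp ((p - 1) * ln t) * t).
      + field. lra.
      + rewrite <- (exp_ln t) at 2 by auto. rewrite <- exp_plus. f_equal. ring.
    - intros t Ht. specialize (Hm t Ht).
      apply (ex_derive_continuous (V := R_NormedModule)). unfold gamma_density. auto_derive. auto. }
  apply (is_RInt_unique (V := R_CompleteNormedModule)) in D.
  pose proof (gamma_density_ex_RInt p a b Ha Hb) as I1.
  pose proof (gamma_density_ex_RInt (p + 1) a b Ha Hb) as I2.
  rewrite (RInt_minus (V := R_CompleteNormedModule) (fun t => p * gamma_density p t)) in D;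
    [|apply (ex_RInt_scal (V := R_NormedModule)); auto|auto].
  rewrite (RInt_scal (V := R_CompleteNormedModule) (gamma_density p)) in D by auto.
  change (p * RInt (gamma_density p) a b - RInt (gamma_density (p + 1)) a b
    = exp (p * ln b) * exp (- b) - exp (p * ln a) * exp (- a)) in D. lra.
Qed.

(** From ln u <= u - 1 at u = t / (2p). *)
Lemma power_exp_le p : 0 < p -> exists K, 0 < K /\
  forall t, 0 < t -> exp (p * ln t) * exp (- t) <= K * exp (- t / 2).
Proof.
  intros Hp. exists (exp (p * ln (2 * p))). split; [apply exp_pos|]. intros t Ht.
  rewrite <- !exp_plus.
  assert (H : ln t <= t / (2 * p) + ln (2 * p)).
  { replace t with (t / (2 * p) * (2 * p)) at 1 by (field; lra).
    assert (H0 : 0 < t / (2 * p)) by (apply Rdiv_lt_0_compat; lra).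
    rewrite ln_mult by lra.
    generalize (exp_ineq1_le (ln (t / (2 * p)))). rewrite exp_ln by auto. lra. }
  apply (Rmult_le_compat_l p) in H; [|lra].
  replace (p * (t / (2 * p) + ln (2 * p))) with (t / 2 + p * ln (2 * p)) in H by (field; lra).
  assert (H' : p * ln t + - t <= p * ln (2 * p) + - t / 2) by lra.
  destruct H' as [H'|H']; [left; now apply exp_increasing|right; now rewrite H'].
Qed.

Lemma power_exp_at_infty p : 0 < p ->
  filterlim (fun t => exp (p * ln t) * exp (- t)) (Rbar_locally p_infty) (locally 0).
Proof.
  intros Hp. destruct (power_exp_le p Hp) as (K & HK & HB).
  apply filterlim_locally. intros eps.
  exists (Rmax 0 (- (2 * ln (eps / K)))). intros t Ht.
  assert (Ht0 : 0 < t) by (eapply Rle_lt_trans; [apply Rmax_l|apply Ht]).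
  assert (Ht1 : - (2 * ln (eps / K)) < t) by (eapply Rle_lt_trans; [apply Rmax_r|apply Ht]).
  unfold ball; simpl; unfold AbsRing_ball, abs, minus, plus, opp; simpl.
  rewrite Ropp_0, Rplus_0_r, Rabs_pos_eq
    by (apply Rlt_le, Rmult_lt_0_compat; apply exp_pos).
  apply Rle_lt_trans with (1 := HB t Ht0).
  assert (He : 0 < eps / K) by (apply Rdiv_lt_0_compat; [apply cond_pos|auto]).
  assert (H : exp (- t / 2) < eps / K).
  { rewrite <- (exp_ln (eps / K)) by auto. apply exp_increasing. lra. }
  apply Rlt_div_r in H; auto. lra.
Qed.

Lemma power_exp_at_0 p : 0 < p ->
  filterlim (fun t => exp (p * ln t) * exp (- t)) (at_right 0) (locally 0).
Proof.
  intros Hp. apply filterlim_locally. intros eps.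
  exists (mkposreal _ (exp_pos (ln eps / p))). intros t Hb Ht.
  unfold ball in *; simpl in *; unfold AbsRing_ball, abs, minus, plus, opp in *; simpl in *.
  rewrite Ropp_0, Rplus_0_r in *. rewrite (Rabs_pos_eq t) in Hb by lra.
  rewrite Rabs_pos_eq by (apply Rlt_le, Rmult_lt_0_compat; apply exp_pos).
  apply ln_increasing in Hb; auto. rewrite ln_exp in Hb. apply Rlt_div_r in Hb; auto.
  assert (H1 : exp (p * ln t) < eps).
  { rewrite <- (exp_ln eps) by apply cond_pos. apply exp_increasing. lra. }
  assert (H2 : exp (- t) < 1) by (rewrite <- exp_0; apply exp_increasing; lra).
  generalize (exp_pos (p * ln t)) (exp_pos (- t)). intros. nra.
Qed.

Definition gamma_filter : (R * R -> Prop) -> Prop :=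
  filter_prod (at_right 0) (Rbar_locally p_infty).

Lemma gamma_filter_pos : gamma_filter (fun ab => 0 < fst ab /\ 0 < snd ab).
Proof.
  apply (Filter_prod _ _ _ (fun a => 0 < a) (fun b => 0 < b)).
  - exists (mkposreal 1 Rlt_0_1). auto.
  - exists 0. auto.
  - auto.
Qed.

Lemma is_gamma_filterlim p l :
  is_gamma p l <-> filterlim (fun ab => RInt (gamma_density p) (fst ab) (snd ab)) gamma_filter (locally l).
Proof.
  split.
  - intros H P HP. specialize (H P HP). unfold filtermap, filtermapi in *.
    change gamma_filter with (filter_prod (at_right 0) (Rbar_locally p_infty)).
    revert H. apply filter_imp. intros ab (y & Hy & Py).
    apply (is_RInt_unique (V := R_CompleteNormedModule)) in Hy. now rewrite Hy.
  - intros H P HP. specialize (H P HP). unfold filtermap in H. unfold filtermapi.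
    generalize (filter_and _ _ gamma_filter_pos H). apply filter_imp.
    intros ab [[Ha Hb] HP']. exists (RInt (gamma_density p) (fst ab) (snd ab)). split; auto.
    apply (RInt_correct (V := R_CompleteNormedModule)). now apply gamma_density_ex_RInt.
Qed.

Lemma gamma_boundary p : 0 < p ->
  filterlim (fun ab => exp (p * ln (snd ab)) * exp (- snd ab) - exp (p * ln (fst ab)) * exp (- fst ab))
    gamma_filter (locally 0).
Proof.
  intros Hp. replace (locally 0) with (locally (0 + - 0)) by (f_equal; ring). unfold Rminus.
  apply (filterlim_comp_2 (G := locally 0) (H := locally (- 0))
    (fun ab => exp (p * ln (snd ab)) * exp (- snd ab))
    (fun ab => - (exp (p * ln (fst ab)) * exp (- fst ab))) Rplus).
  - apply (filterlim_comp _ _ _ snd (fun t => exp (p * ln t) * exp (- t)) _ _ _ filterlim_snd). now apply power_exp_at_infty.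
  - apply (filterlim_comp _ _ _ (fun ab => exp (p * ln (fst ab)) * exp (- fst ab)) Ropp _ (locally 0)).
    + apply (filterlim_comp _ _ _ fst (fun t => exp (p * ln t) * exp (- t)) _ _ _ filterlim_fst). now apply power_exp_at_0.
    + apply (filterlim_opp (K := R_AbsRing) (V := R_NormedModule)).
  - apply (filterlim_plus (K := R_AbsRing) (V := R_NormedModule)).
Qed.

Lemma is_gamma_S p l : 0 < p -> is_gamma p l -> is_gamma (p + 1) (p * l).
Proof.
  intros Hp H. apply is_gamma_filterlim in H. apply is_gamma_filterlim.
  apply filterlim_ext_loc with (fun ab => p * RInt (gamma_density p) (fst ab) (snd ab) +
     - (exp (p * ln (snd ab)) * exp (- snd ab) - exp (p * ln (fst ab)) * exp (- fst ab))).
  - generalize gamma_filter_pos. apply filter_imp. intros ab [Ha Hb].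
    now rewrite gamma_density_parts.
  - replace (p * l) with (p * l + - 0) by ring.
    apply (filterlim_comp_2 (G := locally (p * l)) (H := locally (- 0)) _ _ Rplus).
    + apply (filterlim_comp _ _ _ _ (Rmult p) _ _ _ H).
      apply (filterlim_scal_r (K := R_AbsRing) (V := R_NormedModule) p l).
    + apply (filterlim_comp _ _ _ _ Ropp _ _ _ (gamma_boundary p Hp)).
      apply (filterlim_opp (K := R_AbsRing) (V := R_NormedModule)).
    + apply (filterlim_plus (K := R_AbsRing) (V := R_NormedModule)).
Qed.

Lemma is_gamma_pred p l : 0 < p -> is_gamma (p + 1) l -> is_gamma p (/ p * l).
Proof.
  intros Hp H. apply is_gamma_filterlim in H. apply is_gamma_filterlim.
  apply filterlim_ext_loc with (fun ab => / p * (RInt (gamma_density (p + 1)) (fst ab) (snd ab) +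
     (exp (p * ln (snd ab)) * exp (- snd ab) - exp (p * ln (fst ab)) * exp (- fst ab)))).
  - generalize gamma_filter_pos. apply filter_imp. intros ab [Ha Hb].
    rewrite gamma_density_parts by auto. field. lra.
  - apply (filterlim_comp _ _ _ (fun ab => RInt (gamma_density (p + 1)) (fst ab) (snd ab) +
     (exp (p * ln (snd ab)) * exp (- snd ab) - exp (p * ln (fst ab)) * exp (- fst ab)))
       (Rmult (/ p)) _ (locally l)).
    + replace l with (l + 0) by ring.
      apply (filterlim_comp_2 (G := locally l) (H := locally 0) _ _ Rplus).
      * exact H.
      * apply (gamma_boundary p Hp).
      * apply (filterlim_plus (K := R_AbsRing) (V := R_NormedModule)).
    + apply (filterlim_scal_r (K := R_AbsRing) (V := R_NormedModule) (/ p) l).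
Qed.

Lemma gamma_integral_mono p a b a' b' : 0 < a' -> a' <= a -> a < b -> b <= b' ->
  RInt (gamma_density p) a b <= RInt (gamma_density p) a' b'.
Proof.
  intros Ha Haa Hab Hbb.
  assert (I : forall u v, 0 < u -> 0 < v -> ex_RInt (gamma_density p) u v)
    by (intros; now apply gamma_density_ex_RInt).
  assert (N : forall u v, 0 < u <= v -> 0 <= RInt (gamma_density p) u v).
  { intros u v Hu. apply RInt_ge_0; [lra|apply I; lra|].
    intros; apply Rlt_le, gamma_density_pos. }
  rewrite <- (RInt_Chasles (V := R_CompleteNormedModule) (gamma_density p) a' a b') by (apply I; lra).
  rewrite <- (RInt_Chasles (V := R_CompleteNormedModule) (gamma_density p) a b b') by (apply I; lra).
  generalize (N a' a ltac:(lra)) (N b b' ltac:(lra)). unfold plus; simpl. lra.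
Qed.

(** For an exponent p > 0 of t the proper integrals are bounded and increase
    with the interval, so that they converge to their supremum.  Integration by
    parts extends this to p - 1, where the integrand may be unbounded at 0. *)
Lemma is_gamma_ex p : 0 < p -> exists l, 0 < l /\ is_gamma p l.
Proof.
  intros Hp0.
  assert (Large : forall p, 0 < p -> exists l, 0 < l /\ is_gamma (p + 1) l).
  { clear p Hp0. intros p Hp. destruct (power_exp_le p Hp) as (K & HK & HB).
    assert (Hup : forall a b, 0 < a < b -> RInt (gamma_density (p + 1)) a b <= 2 * K).
    { intros a b Hab.
      assert (Int : is_RInt (fun t => K * exp (- t / 2)) a b (- 2 * K * exp (- b / 2) - - 2 * K * exp (- a / 2))).
      { apply (is_RInt_derive (V := R_CompleteNormedModule) (fun t => - 2 * K * exp (- t / 2))).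
        - intros t _. auto_derive; auto. unfold Rdiv. field.
        - intros t _. apply (ex_derive_continuous (V := R_NormedModule)). auto_derive. auto. }
      apply Rle_trans with (RInt (fun t => K * exp (- t / 2)) a b).
      - apply RInt_le; [lra|apply gamma_density_ex_RInt; lra|eexists; exact Int|].
        intros t Ht. unfold gamma_density. replace (p + 1 - 1) with p by ring. apply HB; lra.
      - rewrite (is_RInt_unique _ _ _ _ Int).
        assert (exp (- a / 2) < 1) by (rewrite <- exp_0; apply exp_increasing; lra).
        generalize (exp_pos (- b / 2)). intros. nra. }
    destruct (completeness (fun x => exists a b, 0 < a < b /\ x = RInt (gamma_density (p + 1)) a b)) as [l [Hl1 Hl2]].
    - exists (2 * K). intros x (a & b & Hab & ->). now apply Hup.
    - exists (RInt (gamma_density (p + 1)) 1 2), 1, 2. split; [lra|auto].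
    - exists l. split.
      + apply Rlt_le_trans with (RInt (gamma_density (p + 1)) 1 2).
        * apply RInt_gt_0; [lra| |]; intros; [apply gamma_density_pos|].
          apply gamma_density_continuous; lra.
        * apply Hl1. exists 1, 2. split; [lra|auto].
      + apply is_gamma_filterlim, filterlim_locally. intros eps.
        assert (Ex : exists a b, 0 < a < b /\ l - eps < RInt (gamma_density (p + 1)) a b).
        { apply Classical_Prop.NNPP. intros Hn.
          assert (l <= l - eps); [|generalize (cond_pos eps); lra].
          apply Hl2. intros x (a & b & Hab & ->). apply Rnot_lt_le. intros Hlt.
          apply Hn. exists a, b. auto. }
        destruct Ex as (a0 & b0 & Hab0 & Hlt).
        apply (Filter_prod _ _ _ (fun a => 0 < a < a0) (fun b => b0 < b)).
        * assert (Ha0 : 0 < a0) by lra. exists (mkposreal a0 Ha0). intros t Hb Ht.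
          unfold ball in Hb; simpl in Hb; unfold AbsRing_ball, abs, minus, plus, opp in Hb; simpl in Hb.
          rewrite Ropp_0, Rplus_0_r, Rabs_pos_eq in Hb by lra. lra.
        * exists b0. auto.
        * intros a b Ha Hb. simpl.
          assert (H1 : RInt (gamma_density (p + 1)) a b <= l)
            by (apply Hl1; exists a, b; split; [lra|auto]).
          assert (H2 : RInt (gamma_density (p + 1)) a0 b0 <= RInt (gamma_density (p + 1)) a b)
            by (apply gamma_integral_mono; lra).
          unfold ball; simpl; unfold AbsRing_ball, abs, minus, plus, opp; simpl.
          apply Rabs_def1; lra. }
  destruct (Large p Hp0) as (l & Hl & H). exists (/ p * l). split.
  - apply Rmult_lt_0_compat; auto. now apply Rinv_0_lt_compat.
  - now apply is_gamma_pred.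
Qed.

Lemma Gamma_integral_real p l : is_gamma p l -> Gamma_integral (RtoC p) = RtoC l.
Proof.
  intros H. unfold Gamma_integral. apply (is_RInt_gen_unique (V := C_R_CompleteNormedModule)).
  intros P HP. assert (HP' : locally l (fun x => P (RtoC x))).
  { destruct HP as [eps Heps]. exists eps. intros x Hx. apply Heps.
    split; [exact Hx|apply (ball_center (M := R_UniformSpace))]. }
  specialize (H _ HP'). unfold filtermapi in *. revert H. apply filter_imp.
  intros ab (x & Hx & Px). exists (RtoC x). split; auto.
  apply (is_RInt_ext (V := C_R_NormedModule) (fun t => (gamma_density p t, 0))).
  - intros t _. rewrite <- RtoC_minus. unfold Rcpow, Cexp, gamma_density.
    rewrite <- RtoC_mult. simpl. rewrite cos_0, sin_0.
    unfold Cmult, RtoC; simpl. f_equal; ring.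
  - apply (is_RInt_fct_extend_pair (U := R_NormedModule) (V := R_NormedModule)); simpl.
    + exact Hx.
    + pose proof (is_RInt_const (V := R_NormedModule) (fst ab) (snd ab) 0) as Z.
      replace (scal (snd ab - fst ab) (0 : R_NormedModule)) with (0 : R_NormedModule) in Z
        by (symmetry; apply Rmult_0_r).
      exact Z.
Qed.

Lemma Gamma_pos_arg p : 0 < p -> Gamma (RtoC p) = Gamma_integral (RtoC p).
Proof.
  intros Hp. unfold Gamma.
  assert (E : Z.to_nat (up (- Re (RtoC p))) = 0%nat).
  { simpl. destruct (archimed (- p)) as [_ H]. 
    assert (up (- p) < 1)%Z by (apply lt_IZR; simpl; lra).
    lia. }
  rewrite E. simpl. rewrite Cplus_0_r. field.
Qed.

Lemma Gamma_neq_0 p : 0 < p -> Gamma (RtoC p) <> 0.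
Proof.
  intros Hp. destruct (is_gamma_ex p Hp) as (l & Hl & H).
  rewrite Gamma_pos_arg, (Gamma_integral_real p l) by auto.
  intros E. apply RtoC_inj in E. lra.
Qed.

(** For p < 0 this is how [Gamma] continues Euler's integral. *)
Lemma Gamma_S p : -1 < p -> p <> 0 -> Gamma (RtoC p + 1) = (RtoC p * Gamma (RtoC p))%C.
Proof.
  intros Hp Hp0. rewrite <- RtoC_plus. destruct (Rlt_le_dec 0 p) as [H|H].
  - destruct (is_gamma_ex p H) as (l & Hl & G).
    rewrite !Gamma_pos_arg by lra.
    rewrite (Gamma_integral_real p l G), (Gamma_integral_real _ _ (is_gamma_S p l H G)).
    now rewrite RtoC_mult.
  - rewrite Gamma_pos_arg by lra. unfold Gamma.
    assert (E : Z.to_nat (up (- Re (RtoC p))) = 1%nat).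
    { simpl. rewrite <- (tech_up (- p) 1); simpl; auto; lra. }
    rewrite E. simpl. rewrite RtoC_plus, Cplus_0_r.
    assert (RtoC p <> RtoC 0) by (intros E'; apply RtoC_inj in E'; lra).
    field. auto.
Qed.

Lemma Gamma_poch p n : -1 < p -> p <> 0 ->
  Gamma (RtoC p + nC n) = (pochhammer (RtoC p) n * Gamma (RtoC p))%C.
Proof.
  intros Hp Hp0. induction n.
  - simpl. rewrite Cplus_0_r. ring.
  - rewrite nC_S, Cplus_assoc, <- RtoC_plus, Gamma_S, RtoC_plus, IHn, poch_S; [ring| |].
    + generalize (pos_INR n). lra.
    + destruct n; [simpl; lra|]. rewrite S_INR. generalize (pos_INR n). lra.
Qed.

Lemma Gamma_gt_m1_neq_0 p : -1 < p -> p <> 0 -> Gamma (RtoC p) <> 0.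
Proof.
  intros Hp Hp0 E. apply (Gamma_neq_0 (p + 1)); [lra|].
  rewrite RtoC_plus, Gamma_S, E by auto. ring.
Qed.

(** * Jacobi polynomials and [gpoly] *)

Lemma hyp2F1_comm a b c z : hyp2F1 a b c z = hyp2F1 b a c z.
Proof.
  unfold hyp2F1, CSeries. f_equal; apply Series_ext; intros n;
    now rewrite (Cmult_comm (pochhammer a n)).
Qed.

Lemma poch_neg_nat n m : pochhammer (- nC n) m = ((-(1)) ^ m * nC (fact n) * rfact n m)%C.
Proof.
  induction m.
  - rewrite rfact_0. simpl. field. apply fact_nC_neq_0.
  - rewrite poch_S, IHm, <- rfact_down. simpl Cpow. ring.
Qed.

Lemma jacobi_gpoly k alpha gamma x : nonpole (alpha + 1) -> nonpole (alpha + gamma + 1) ->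
  jacobi k alpha gamma x
  = (pochhammer (alpha + 1) k / pochhammer (alpha + gamma + 1) k
     * gpoly (alpha + gamma + 1) (alpha + 1) k ((1 - x) / 2))%C.
Proof.
  intros Hc Hs. unfold jacobi.
  set (u := fun m => (pochhammer (- nC k) m * pochhammer (nC k + alpha + gamma + 1) m
     / (pochhammer (alpha + 1) m * nC (fact m)) * ((1 - x) / 2) ^ m)%C).
  assert (E : hyp2F1 (- nC k) (nC k + alpha + gamma + 1) (alpha + 1) ((1 - x) / 2) = csum u k).
  { apply CSeries_unique. apply (is_series_finite u k).
    intros m Hm. unfold u. rewrite poch_neg_nat, rfact_gt by auto. unfold Cdiv. ring. }
  rewrite E. unfold gpoly. rewrite <- !csum_mult_l. apply csum_ext. intros m Hm.
  unfold u, gcoef. rewrite poch_neg_nat, (poch_add (alpha + gamma + 1) k m).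
  replace (nC k + alpha + gamma + 1)%C with (alpha + gamma + 1 + nC k)%C by ring.
  field. nz.
Qed.

(** * Expansion of the generating function in other Jacobi polynomials *)

Definition connection_row (a s c : C) (rho : R) (y : C) (k : nat) : C :=
  (RtoC rho ^ k * (pochhammer a (2 * k) * (s + 2 * nC k) / pochhammer s (2 * k + 1))
   * hyp2F1 (a - s) (a + nC (2 * k)) (s + nC (2 * k + 1)) (- RtoC rho) * gpoly s c k y)%C.

(** The connection formula makes the generating function the sum over the
    antidiagonals of a double series; its rows are Gauss series at -rho. *)
Lemma gpoly_series_connection a s c rho y :
  nonpole s -> nonpole c -> 0 < rho < 1 -> 0 <= y <= 1 ->
  exists S : C, is_series (connection_row a s c rho (RtoC y)) S /\
    is_series (fun n => RtoC rho ^ n * gpoly a c n (RtoC y))%C S.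
Proof.
  intros Hs Hc Hr Hy.
  set (d := fun k j => (RtoC rho ^ (k + j) * (pochhammer a (2 * k + j) * (s + 2 * nC k)
      / pochhammer s (2 * k + 1 + j) * ((-(1)) ^ j * pochhammer (a - s) j / nC (fact j)))
      * gpoly s c k (RtoC y))%C).
  assert (Hrow : forall k, is_series (d k) (connection_row a s c rho (RtoC y) k)).
  { intros k.
    pose proof (hyp2F1_is_series (a - s) (a + nC (2 * k)) (s + nC (2 * k + 1)) (- RtoC rho)
       (nonpole_shift s _ Hs)) as H.
    rewrite Cmod_opp, Cmod_R, Rabs_pos_eq in H by lra. specialize (H Hr).
    apply (is_series_Cmult_l (RtoC rho ^ k * (pochhammer a (2 * k) * (s + 2 * nC k)
      / pochhammer s (2 * k + 1)) * gpoly s c k (RtoC y))%C) in H.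
    replace (connection_row a s c rho (RtoC y) k) with
     (RtoC rho ^ k * (pochhammer a (2 * k) * (s + 2 * nC k)
      / pochhammer s (2 * k + 1)) * gpoly s c k (RtoC y)
      * hyp2F1 (a - s) (a + nC (2 * k)) (s + nC (2 * k + 1)) (- RtoC rho))%C
      by (unfold connection_row; ring).
    revert H. apply is_series_Cext. intros j. unfold d.
    pose proof (nonpole_shift s (2 * k + 1) Hs).
    rewrite !poch_add, Cpow_add_r.
    replace (- RtoC rho)%C with (-(1) * RtoC rho)%C by ring. rewrite Cpow_mult_l.
    rewrite <- !poch_add, !(poch_add _ _ j). field. nz. }
  destruct (room_for_subexponential rho Hr) as (q4 & Hq4 & Hqr4).
  set (p := q4 ^ 4) in *.
  assert (Hp : 1 < p) by (apply Rlt_pow_R1; lra || lia).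
  assert (Hpr : 0 < p * rho < 1) by lra.
  assert (Hq' : exists q, 1 < q /\ q ^ 8 = p).
  { exists (sqrt (sqrt (sqrt p))).
    assert (S1 : 1 < sqrt p) by (rewrite <- sqrt_1; apply sqrt_lt_1; lra).
    assert (S2 : 1 < sqrt (sqrt p)) by (rewrite <- sqrt_1; apply sqrt_lt_1; lra).
    split; [rewrite <- sqrt_1; apply sqrt_lt_1; lra|].
    change 8%nat with (2 * (2 * 2))%nat.
    now rewrite !pow_mult, !pow2_sqrt by lra. }
  destruct Hq' as (q & Hq & Hq8).
  destruct (poch_ratio_bound a s q Hs Hq) as (K1 & HK1 & B1).
  destruct (poch_ratio_bound (a - s) 1 q (nonpole_pos 1 Rlt_0_1) Hq) as (K2 & HK2 & B2).
  destruct (gpoly_bound s c q Hc Hq) as (K3 & HK3 & B3).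
  (* (s+2k)/(s+n) is written as a product of two ratios of Pochhammer symbols,
     for which a subexponential bound is available *)
  destruct (poch_ratio_bound (s + 1) s q Hs Hq) as (L1 & HL1 & A1).
  destruct (poch_ratio_bound s (s + 1) q (nonpole_S s Hs) Hq) as (L2 & HL2 & A2).
  assert (Hs0 : s <> RtoC 0)
    by (generalize (Hs 0%nat); simpl; now rewrite Cplus_0_r).
  assert (T : forall n, pochhammer (s + 1) n = (pochhammer s n * (s + nC n) / s)%C).
  { intros n. assert (E : (s * pochhammer (s + 1) n = pochhammer s n * (s + nC n))%C)
      by (rewrite <- poch_Sl; reflexivity).
    rewrite <- E. field. auto. }
  destruct (double_series d (connection_row a s c rho (RtoC y)) (K1 * (L1 * L2) * K2 * K3) (p * rho))
    as (S & HS1 & HS2); auto.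
  { repeat apply Rmult_le_pos; auto. }
  { intros k j. set (n := (2 * k + j)%nat).
    replace (d k j) with ((pochhammer a n / pochhammer s n)
       * ((pochhammer (s + 1) (2 * k) / pochhammer s (2 * k))
          * (pochhammer s n / pochhammer (s + 1) n))
       * (pochhammer (a - s) j / pochhammer 1 j) * gpoly s c k (RtoC y)
       * ((-(1)) ^ j * RtoC rho ^ (k + j)))%C.
    - rewrite !Cmod_mult, !Cmod_pow, Cmod_m1, pow1, Rmult_1_l, (Cmod_R rho), (Rabs_pos_eq rho) by lra.
      rewrite Rpow_mult_distr, <- (Rmult_assoc _ (p ^ (k + j))).
      apply Rmult_le_compat_r; [apply pow_le; lra|].
      apply Rle_trans with ((K1 * q ^ n) * ((L1 * q ^ (2 * k)) * (L2 * q ^ n)) * (K2 * q ^ j) * (K3 * q ^ k)).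
      + repeat apply Rmult_le_compat; auto using Cmod_ge_0;
          repeat apply Rmult_le_pos; auto using Cmod_ge_0.
      + replace (K1 * q ^ n * (L1 * q ^ (2 * k) * (L2 * q ^ n)) * (K2 * q ^ j) * (K3 * q ^ k))
          with (K1 * (L1 * L2) * K2 * K3 * q ^ (n + 2 * k + n + j + k)) by (rewrite !pow_add; ring).
        apply Rmult_le_compat_l; [repeat apply Rmult_le_pos; auto|].
        rewrite <- Hq8, <- pow_mult. apply Rle_pow; [lra|unfold n; lia].
    - unfold d. fold n. rewrite !T, poch_one.
      replace (2 * k + 1 + j)%nat with (Datatypes.S n) by (unfold n; lia).
      rewrite poch_S, nC_mult. simpl (INR 2). rewrite RtoC_plus.
      replace ((1 + 1) * nC k)%C with (2 * nC k)%C by ring.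
      assert (Hk : (s + 2 * nC k)%C <> RtoC 0).
      { replace (2 * nC k)%C with (nC (k + k)) by (rewrite nC_plus; ring). apply Hs. }
      field. nz. }
  exists S. split; auto.
  revert HS2. apply is_series_Cext. intros n.
  rewrite (gpoly_connection a s c n (RtoC y) Hs Hc), <- csum_mult_l.
  apply csum_ext. intros k Hk. unfold d, connection_coef. rewrite rfact_le by auto.
  replace (k + (n - k))%nat with n by lia.
  replace (2 * k + (n - k))%nat with (n + k)%nat by lia.
  replace (2 * k + 1 + (n - k))%nat with (Datatypes.S (n + k)) by lia.
  unfold Cdiv. ring.
Qed.

Lemma gpoly_Cderiv a c n u : nonpole c ->
  Cderiv (fun u => gpoly a c (S n) (RtoC u)) u
    (- a * (a + 1) / c * gpoly (a + 2) (c + 1) n (RtoC u))%C.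
Proof.
  intros Hc.
  replace (- a * (a + 1) / c * gpoly (a + 2) (c + 1) n (RtoC u))%C
    with (csum (fun m => gcoef a c (S n) m * RtoC (INR m * u ^ pred m))%C (S n)).
  - apply Cderiv_ext with (fun u => csum (fun m => gcoef a c (S n) m * RtoC (u ^ m))%C (S n)).
    { intros v. apply csum_ext. intros m _. now rewrite RtoC_pow. }
    apply (Cderiv_csum (fun m u => gcoef a c (S n) m * RtoC (u ^ m))%C). intros m.
    apply (Cderiv_scal _ (fun u => RtoC (u ^ m))), Cderiv_real.
    auto_derive; auto. ring.
  - rewrite csum_shift. simpl (INR 0). rewrite Rmult_0_l, Cmult_0_r, Cplus_0_l.
    unfold gpoly. rewrite <- csum_mult_l. apply csum_ext. intros m _.
    rewrite Cmult_assoc, <- gcoef_derive by auto.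
    simpl pred. rewrite RtoC_mult, RtoC_pow. ring.
Qed.

(** The derivatives of the polynomials are [gpoly]s with shifted parameters, so
    that [gpoly_bound] applies to them as well.  This gives the limit as x
    tends to 1, where y = (1-x)/2 tends to 0. *)
Lemma gpoly_series_Lipschitz a c rho : nonpole c -> 0 < rho < 1 ->
  exists M, 0 <= M /\ forall y (s s0 : C), 0 <= y <= 1 ->
  is_series (fun n => RtoC rho ^ n * gpoly a c n (RtoC y))%C s ->
  is_series (fun n => RtoC rho ^ n * gpoly a c n (RtoC 0))%C s0 ->
  Cmod (s - s0) <= M * y.
Proof.
  intros Hc Hr. destruct (room_for_subexponential rho Hr) as (q & Hq & Hqr).
  set (p := q ^ 4) in *. assert (Hp : 1 < p) by (apply Rlt_pow_R1; lra || lia).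
  destruct (gpoly_bound (a + 2) (c + 1) p (nonpole_S c Hc) Hp) as (K & HK & HB).
  set (L := Cmod (- a * (a + 1) / c)). assert (HL : 0 <= L) by apply Cmod_ge_0.
  exists (2 * (L * K) / (1 - p * rho)). split.
  { apply Rle_div_r; [lra|]. rewrite Rmult_0_l. apply Rmult_le_pos; [lra|]. now apply Rmult_le_pos. }
  intros y s s0 Hy Hs Hs0.
  replace (2 * (L * K) / (1 - p * rho) * y) with (2 * (L * K) * y / (1 - p * rho)) by (field; lra).
  refine (series_bound _ _ _ _ _ _ _ (is_series_Cminus _ _ _ _ Hs Hs0)); [lra| |].
  { repeat apply Rmult_le_pos; lra. }
  intros n. replace (RtoC rho ^ n * gpoly a c n (RtoC y) - RtoC rho ^ n * gpoly a c n (RtoC 0))%C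
    with (RtoC rho ^ n * (gpoly a c n (RtoC y) - gpoly a c n (RtoC 0)))%C by ring.
  rewrite Cmod_mult, Cmod_pow, Cmod_R, Rabs_pos_eq by lra.
  rewrite Rpow_mult_distr, <- (Rmult_assoc _ (p ^ n)), Rmult_comm.
  apply Rmult_le_compat_r; [apply pow_le; lra|].
  destruct n as [|n].
  - unfold gpoly. rewrite !csum_O. simpl Cpow.
    replace (gcoef a c 0 0 * 1 - gcoef a c 0 0 * 1)%C with (RtoC 0) by ring.
    rewrite Cmod_0. repeat apply Rmult_le_pos; simpl; lra.
  - pose proof (Cmod_mean_value (fun u => gpoly a c (S n) (RtoC u))
      (fun u => - a * (a + 1) / c * gpoly (a + 2) (c + 1) n (RtoC u))%C (L * (K * p ^ n)) 0 y) as MV.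
    cbv beta in MV. eapply Rle_trans; [apply MV|].
    + lra.
    + intros u Hu. split; [now apply gpoly_Cderiv|]. rewrite Cmod_mult.
      apply Rmult_le_compat_l; auto. apply HB. lra.
    + assert (p ^ n <= p ^ S n) by (apply Rle_pow; lra || lia).
      replace (2 * (L * (K * p ^ n)) * (y - 0)) with (2 * (L * K) * y * p ^ n) by ring.
      apply Rmult_le_compat_l; auto. repeat apply Rmult_le_pos; lra.
Qed.

(** * The two sides of the expansion *)

Definition ferrers_lhs (alpha rho : R) (beta : C) (x : R) : C :=
  let Rx := sqrt (1 + rho ^ 2 - 2 * rho * x) in
  (Rcpow (1 - x) (RtoC (- alpha / 2)) / Rcpow Rx (beta + RtoC 1)
     * ferrersP beta (RtoC (- alpha)) ((1 - rho) / Rx))%C.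

(** Let (r,1) be the end of the characteristic through (rho,y).  The argument
    (1-rho)/Rx of the Ferrers function is (1-r)/(1+r), so that its Gauss
    function has the argument r/(1+r).  Pfaff's transformation makes it the
    value of the generating function at (r,1), which the characteristic carries
    to (rho,y).  All the powers combine to (rho/2)^(alpha/2). *)
Lemma ferrers_lhs_series alpha rho beta x (s : C) :
  -1 < alpha -> 0 < rho < 1 -> -1 <= x < 1 ->
  is_series (fun n => RtoC rho ^ n
    * gpoly (RtoC alpha + beta + 1) (RtoC (alpha + 1)) n (RtoC ((1 - x) / 2)))%C s ->
  ferrers_lhs alpha rho beta x
  = (Rcpow (rho / 2) (RtoC (alpha / 2)) / Gamma (RtoC (alpha + 1)) * s)%C.
Proof.
  intros halpha hrho Hx Hs.
  set (h := RtoC (alpha / 2)). set (c := RtoC (alpha + 1)) in *.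
  set (a := (RtoC alpha + beta + 1)%C) in *.
  set (y := (1 - x) / 2) in *.
  unfold ferrers_lhs. set (Rx := sqrt (1 + rho ^ 2 - 2 * rho * x)). cbv zeta.
  assert (HR2 : Rx * Rx = (1 - rho) * (1 - rho) + 4 * rho * y).
  { unfold Rx. rewrite sqrt_sqrt; [unfold y; field|]. nra. }
  assert (HR0 : 0 <= Rx) by apply sqrt_pos.
  assert (Hy : 0 < y <= 1) by (unfold y; lra).
  assert (HRl : 1 - rho < Rx) by nra.
  assert (HRu : Rx <= 1 + rho) by nra.
  set (r := (Rx - (1 - rho)) / (Rx + (1 - rho))).
  assert (Hr0 : 0 < r) by (apply Rdiv_lt_0_compat; lra).
  assert (Hrr : r <= rho) by (apply Rle_div_l; nra).
  assert (E1 : 1 - r = 2 * (1 - rho) / (Rx + (1 - rho))) by (unfold r; field; lra).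
  assert (HRr : Rx = (1 - rho) * (1 + r) / (1 - r)) by (rewrite E1; unfold r; field; lra).
  assert (Hyr : y = r * ((1 - rho) * (1 - rho)) / (rho * ((1 - r) * (1 - r)))).
  { apply Rmult_eq_reg_l with (4 * rho); [|lra].
    replace (4 * rho * y) with (Rx * Rx - (1 - rho) * (1 - rho)) by lra.
    rewrite HRr. field. lra. }
  assert (Hc : nonpole c) by (apply nonpole_pos; lra).
  pose proof (gpoly_series_transport a c rho y r
    (hyp2F1 a (a - c + 1) c (- RtoC r)) s Hc (conj Hr0 Hrr) (proj2 hrho)) as T.
  assert (HT : r * (1 - rho) ^ 2 = rho * y * (1 - r) ^ 2) by (rewrite Hyr; field; lra).
  specialize (T HT (gpoly_series_at_1 a c r Hc ltac:(lra)) Hs).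
  set (F := hyp2F1 a (a - c + 1) c (- RtoC r)) in T.
  unfold ferrersP.
  replace ((1 + (1 - rho) / Rx) / (1 - (1 - rho) / Rx)) with (/ r)
    by (unfold r; field; repeat split; lra).
  replace ((1 - (1 - rho) / Rx) / 2) with (r / (1 + r)) by (unfold r; field; lra).
  replace (1 - RtoC (- alpha))%C with c by (unfold c; rewrite RtoC_opp, RtoC_plus; ring).
  rewrite (hyp2F1_comm (- beta)).
  rewrite (pfaff_transformation (beta + 1) (- beta) c).
  2: exact Hc.
  2:{ split; [apply Rdiv_lt_0_compat; lra|]. apply Rlt_div_l; lra. }
  replace (r / (1 + r) / (1 - r / (1 + r))) with r by (field; lra).
  replace (1 - r / (1 + r)) with (/ (1 + r)) by (field; lra).
  replace (c - - beta)%C with a by (unfold c, a; rewrite RtoC_plus; ring).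
  rewrite (hyp2F1_comm (beta + 1)).
  replace (hyp2F1 a (beta + 1) c (- RtoC r)) with F
    by (unfold F; f_equal; unfold a, c; rewrite RtoC_plus; ring).
  assert (Ha : a = (h + h + (beta + 1))%C).
  { unfold a, h. rewrite Cplus_assoc. do 2 f_equal. rewrite <- RtoC_plus. f_equal. field. }
  replace (RtoC (- alpha / 2)) with (- h)%C by (unfold h; rewrite <- RtoC_opp; f_equal; field).
  replace (RtoC (- alpha) / RtoC 2)%C with (- h)%C
    by (unfold h; rewrite <- RtoC_opp, <- RtoC_div by lra; f_equal; field).
  replace (1 - x) with (2 * r * ((1 - rho) * (1 - rho)) / (rho * ((1 - r) * (1 - r))))
    by (transitivity (2 * y); [rewrite Hyr|unfold y]; field; lra).
  rewrite HRr.
  assert (0 < (1 - rho) * (1 - rho)) by nra. assert (0 < (1 - r) * (1 - r)) by nra.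
  assert (0 < rho * ((1 - r) * (1 - r))) by nra. assert (0 < 2 * r * ((1 - rho) * (1 - rho))) by nra.
  assert (0 < (1 - rho) * (1 + r)) by nra.
  rewrite !Rcpow_div, !Rcpow_mult, !Rcpow_inv by lra.
  rewrite !Rcpow_opp.
  rewrite Ha, !(Rcpow_plus _ (h + h)), !(Rcpow_plus _ h) in T.
  assert (HG : Gamma c <> 0) by (apply Gamma_neq_0; lra).
  pose proof (Rcpow_neq_0 (1 - rho) h). pose proof (Rcpow_neq_0 (1 - rho) (beta + 1)).
  replace s with (Rcpow (1 - r) h * Rcpow (1 - r) h * Rcpow (1 - r) (beta + 1) * F
     / (Rcpow (1 - rho) h * Rcpow (1 - rho) h * Rcpow (1 - rho) (beta + 1)))%C
    by (rewrite T; field; auto).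
  field. repeat split; auto using Rcpow_neq_0.
Qed.

(** Pfaff's transformation at rho/(1+rho) leads to a Gauss function at -rho and
    a power of 1+rho, which the prefactor cancels; the Gamma function in the
    Ferrers function is (sig)_(2k+1) Gamma(sig). *)
Lemma ferrers_rhs_term alpha rho beta gamma x k (sig : R) :
  -1 < alpha -> 0 < rho < 1 -> sig = gamma + alpha + 1 -> -1 < sig -> sig <> 0 ->
  let prefactor :=
    (Gamma (RtoC (gamma + alpha + 1))
     / (Rcpow 2 (RtoC (alpha / 2)) * Gamma (RtoC (alpha + 1))
        * Rcpow (1 + rho) (beta - RtoC gamma)
        * Rcpow rho (RtoC ((gamma + 1) / 2))))%C in
  (prefactor *
   (RtoC (2 * INR k + gamma + alpha + 1)
       * pochhammer (RtoC (gamma + alpha + 1)) k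
       * pochhammer (RtoC alpha + beta + RtoC 1) (2 * k)
       / pochhammer (RtoC (alpha + 1)) k
       * ferrersP (RtoC gamma - beta) (RtoC (- gamma - alpha - 2 * INR k - 1))
           ((1 - rho) / (1 + rho))
       * jacobi k (RtoC alpha) (RtoC gamma) (RtoC x))
   = Rcpow (rho / 2) (RtoC (alpha / 2)) / Gamma (RtoC (alpha + 1))
     * connection_row (RtoC alpha + beta + 1) (RtoC sig) (RtoC (alpha + 1)) rho
         (RtoC ((1 - x) / 2)) k)%C.
Proof.
  intros halpha hrho Esig Hsig Hsig0 prefactor.
  set (h := RtoC (alpha / 2)). set (c := RtoC (alpha + 1)) in *.
  set (a := (RtoC alpha + beta + 1)%C) in *.
  assert (Hs : nonpole (RtoC sig)) by now apply nonpole_gt_m1.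
  assert (Hc : nonpole c) by (apply nonpole_pos; lra).
  unfold prefactor. rewrite <- Esig.
  rewrite jacobi_gpoly.
  2: rewrite <- RtoC_plus; exact Hc.
  2:{ rewrite <- !RtoC_plus. replace (alpha + gamma + 1) with sig by lra. exact Hs. }
  replace (RtoC alpha + RtoC gamma + 1)%C with (RtoC sig) by (rewrite Esig, !RtoC_plus; ring).
  rewrite <- (RtoC_plus alpha 1). fold c a h.
  replace ((1 - RtoC x) / 2)%C with (RtoC ((1 - x) / 2)) by (rewrite RtoC_div, RtoC_minus by lra; reflexivity).
  unfold ferrersP.
  replace (1 - RtoC (- gamma - alpha - 2 * INR k - 1))%C with (RtoC sig + nC (2 * k + 1))%C.
  2:{ rewrite <- RtoC_minus, <- RtoC_plus, plus_INR, mult_INR. f_equal. simpl. rewrite Esig; ring. }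
  rewrite Gamma_poch by auto.
  replace ((1 + (1 - rho) / (1 + rho)) / (1 - (1 - rho) / (1 + rho))) with (/ rho) by (field; lra).
  replace ((1 - (1 - rho) / (1 + rho)) / 2) with (rho / (1 + rho)) by (field; lra).
  rewrite pfaff_transformation.
  2: now apply nonpole_shift.
  2:{ split; [apply Rdiv_lt_0_compat; lra|]. apply Rlt_div_l; lra. }
  replace (rho / (1 + rho) / (1 - rho / (1 + rho))) with rho by (field; lra).
  replace (1 - rho / (1 + rho)) with (/ (1 + rho)) by (field; lra).
  replace (- (RtoC gamma - beta))%C with (beta - RtoC gamma)%C by ring.
  replace (RtoC sig + nC (2 * k + 1) - (RtoC gamma - beta + 1))%C with (a + nC (2 * k))%C
    by (unfold a; rewrite Esig, nC_plus, !RtoC_plus; simpl (INR 1); ring).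
  replace (RtoC (- gamma - alpha - 2 * INR k - 1) / RtoC 2)%C
    with (- (RtoC ((gamma + 1) / 2) + h + nC k))%C.
  2:{ unfold h. rewrite <- !RtoC_plus, <- RtoC_opp, <- RtoC_div by lra. f_equal. field. }
  rewrite !Rcpow_opp, !Rcpow_inv, !Rcpow_plus, Rcpow_nat, Rcpow_div by lra.
  unfold connection_row.
  replace (a - RtoC sig)%C with (beta - RtoC gamma)%C
    by (unfold a; rewrite Esig, !RtoC_plus; ring).
  replace (RtoC (2 * INR k + gamma + alpha + 1)) with (RtoC sig + 2 * nC k)%C
    by (rewrite <- RtoC_mult, <- RtoC_plus; f_equal; lra).
  field. repeat split; auto using Rcpow_neq_0, nonpole_poch.
  all: try (apply Gamma_gt_m1_neq_0; lra).
  apply Cpow_nz. intros E; apply RtoC_inj in E; lra.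
Qed.

Theorem corollary5 (alpha gamma rho x : R) (beta : C)
  (halpha : -1 < alpha) (hgamma : -1 < gamma)
  (hag : -1 < alpha < 0 -> -1 < gamma < 0 -> alpha + gamma + 1 <> 0)
  (hrho : 0 < rho < 1) (hx : -1 <= x <= 1) :
  let lhs := fun y : R =>
    let Ry := sqrt (1 + rho ^ 2 - 2 * rho * y) in
    (Rcpow (1 - y) (RtoC (- alpha / 2)) / Rcpow Ry (beta + RtoC 1)
     * ferrersP beta (RtoC (- alpha)) ((1 - rho) / Ry))%C in
  let prefactor :=
    (Gamma (RtoC (gamma + alpha + 1))
     / (Rcpow 2 (RtoC (alpha / 2)) * Gamma (RtoC (alpha + 1))
        * Rcpow (1 + rho) (beta - RtoC gamma)
        * Rcpow rho (RtoC ((gamma + 1) / 2))))%C in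
  exists s : C,
    is_series (fun k : nat =>
      (RtoC (2 * INR k + gamma + alpha + 1)
       * pochhammer (RtoC (gamma + alpha + 1)) k
       * pochhammer (RtoC alpha + beta + RtoC 1) (2 * k)
       / pochhammer (RtoC (alpha + 1)) k
       * ferrersP (RtoC gamma - beta) (RtoC (- gamma - alpha - 2 * INR k - 1))
           ((1 - rho) / (1 + rho))
       * jacobi k (RtoC alpha) (RtoC gamma) (RtoC x))%C) s /\
    (x < 1 -> lhs x = (prefactor * s)%C) /\
    (x = 1 -> filterlim lhs (at_left 1) (locally (prefactor * s)%C)).
Proof.
  intros lhs prefactor.
  set (sig := gamma + alpha + 1).
  assert (Hsig : -1 < sig) by (unfold sig; lra).
  assert (Hsig0 : sig <> 0) by (intros E; unfold sig in E; apply hag; lra).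
  set (c := RtoC (alpha + 1)). set (a := (RtoC alpha + beta + 1)%C).
  assert (Hs : nonpole (RtoC sig)) by now apply nonpole_gt_m1.
  assert (Hc : nonpole c) by (apply nonpole_pos; lra).
  set (K := (Rcpow (rho / 2) (RtoC (alpha / 2)) / Gamma c)%C).
  assert (Hy : 0 <= (1 - x) / 2 <= 1) by lra.
  destruct (gpoly_series_connection a (RtoC sig) c rho ((1 - x) / 2) Hs Hc hrho Hy) as (S & HS1 & HS2).
  assert (Hpre : prefactor <> 0).
  { apply Cmult_neq_0; [apply Gamma_gt_m1_neq_0; auto|].
    intros E. apply C1_nz. rewrite <- (Cinv_r (Rcpow 2 (RtoC (alpha / 2)) * Gamma (RtoC (alpha + 1))
        * Rcpow (1 + rho) (beta - RtoC gamma) * Rcpow rho (RtoC ((gamma + 1) / 2)))), E.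
    - ring.
    - apply Cmult_neq_0; [apply Cmult_neq_0; [apply Cmult_neq_0|]|];
        (apply Rcpow_neq_0 || (apply Gamma_neq_0; lra)). }
  exists (/ prefactor * (K * S))%C.
  assert (Es : (prefactor * (/ prefactor * (K * S)) = K * S)%C) by (field; auto).
  rewrite Es. repeat split.
  - apply (is_series_Cmult_l K), (is_series_Cmult_l (/ prefactor)) in HS1.
    revert HS1. apply is_series_Cext. intros k.
    pose proof (ferrers_rhs_term alpha rho beta gamma x k sig halpha hrho eq_refl Hsig Hsig0) as T.
    symmetry in T.
    refine (eq_trans (f_equal (Cmult (/ prefactor)) T) (_ : (/ prefactor * (prefactor * _) = _)%C)).
    rewrite Cmult_assoc, Cinv_l, Cmult_1_l by auto. reflexivity.
  - intros Hx. apply (ferrers_lhs_series alpha rho beta x S); auto. lra.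
  - intros Hx.
    replace ((1 - x) / 2) with 0 in HS2 by (rewrite Hx; field).
    destruct (gpoly_series_Lipschitz a c rho Hc hrho) as (M & HM & HL).
    apply filterlim_locally. intros eps.
    set (L := Cmod K * M + 1).
    assert (HLp : 0 < L) by (unfold L; generalize (Rmult_le_pos _ _ (Cmod_ge_0 K) HM); lra).
    assert (Hd : 0 < Rmin 1 (eps / L)).
    { apply Rmin_glb_lt; [lra|]. apply Rdiv_lt_0_compat; auto. apply cond_pos. }
    exists (mkposreal _ Hd). intros z Hz Hz1. apply C_NormedModule_mixin_compat1.
    unfold ball in Hz; simpl in Hz; unfold AbsRing_ball, abs, minus, plus, opp in Hz; simpl in Hz.
    assert (Hz2 : 1 - z < Rmin 1 (eps / L)).
    { rewrite Rabs_left in Hz by lra. lra. }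
    pose proof (Rmin_l 1 (eps / L)). pose proof (Rmin_r 1 (eps / L)).
    assert (Hyz : 0 <= (1 - z) / 2 <= 1) by lra.
    destruct (gpoly_series_ex a c rho ((1 - z) / 2) Hc hrho Hyz) as [t Ht].
    change (lhs z) with (ferrers_lhs alpha rho beta z).
    rewrite (ferrers_lhs_series alpha rho beta z t halpha hrho) by (auto; lra).
    fold c K. change (minus (K * t)%C (K * S)%C) with (K * t - K * S)%C.
    replace (K * t - K * S)%C with (K * (t - S))%C by ring. rewrite Cmod_mult.
    specialize (HL _ _ _ Hyz Ht HS2).
    assert (H1 : (1 - z) * L < eps) by (apply Rlt_div_r; lra).
    assert (H2 : Cmod K * Cmod (t - S) <= Cmod K * (M * ((1 - z) / 2)))
      by (apply Rmult_le_compat_l; [apply Cmod_ge_0|auto]).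
    unfold L in H1. generalize (Rmult_le_pos _ _ (Cmod_ge_0 K) HM). intros. nra.
Qed.
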